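(* Let $q=e^{\pi i\tau}$ with $\mathrm{Im}(\tau)>0$ (so $0<|q|<1$). Then the following hold. (a) $$\left(\frac{\psi^3(q^3)}{\psi(q^9)}\right)^2 = \left(1 + 3\sum_{n=1}^{\infty}\left(\frac{q^{18n-15}}{1-q^{18n-15}}-\frac{q^{18n-3}}{1-q^{18n-3}} \right) \right)^2 = 1 + 3\sum_{n=1}^{\infty}\left(\frac{q^{6n}}{(1-q^{6n})^2} + \frac{2 q^{6n-3}}{(1-q^{6n-3})^2} - \frac{9 q^{18n}}{(1-q^{18n})^2} \right).$$ (b) $$\left( q\, \psi^4(q^2) \right)^2 = \left(\sum_{n=1}^{\infty} \frac{(2n-1)q^{2n-1}}{1-q^{4n-2}} \right)^2 =\sum_{n=1}^{\infty}\left(\frac{6 q^{8n-4}}{(1-q^{4n-2})^4}+\frac{q^{4n-2}}{(1-q^{4n-2})^2} \right).$$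
   Context: For complex $a$ and $|q|<1$, $(a;q)_\infty=\prod_{i=0}^{\infty}(1-aq^i)$, and Ramanujan's theta function is $\psi(q)=\dfrac{(q^2;q^2)_\infty}{(q;q^2)_\infty}$. *)

(* Defs.v *)
From HB Require Import structures.
From mathcomp Require Export all_boot all_order all_algebra.
From mathcomp Require Export complex.
From mathcomp Require Export all_classical all_reals all_analysis.

Set Implicit Arguments.
Unset Strict Implicit.
Unset Printing Implicit Defensive.

Export Order.TTheory GRing.Theory Num.Theory.
Export numFieldNormedType.Exports.

Local Open Scope ring_scope.
Local Open Scope complex_scope.
Local Open Scope classical_set_scope.

(* MathComp-Analysis puts the norm topology on K^o for every numFieldType K;
   this gives the type R[i] itself that topology, so that limits can be taken
   in it. *)
HB.instance Definition _ (R : realType) := NormedModule.copy R[i] R[i]^o.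

Definition cexp (R : realType) (z : R[i]) : R[i] :=
  (expR (complex.Re z))%:C * (cos (complex.Im z) +i* sin (complex.Im z)).

(* (a; q)_oo.  The big operators indexed by (m <= n <oo) are limits of partial
   products, resp. sums; they have their intended meaning only when these
   converge, which is the case here for |q| < 1. *)
Definition qpoch (R : realType) (a q : R[i]) : R[i] :=
  \big[*%R/1]_(0 <= i <oo) (1 - a * q ^+ i).

Notation "\csum_ ( m <= n '<oo' ) F" := (\big[+%R/0%R]_(m <= n <oo) F%R)
  (at level 41, F at level 41, m, n at level 50,
   format "'[' \csum_ ( m  <=  n  <oo ) '/  '  F ']'") : ring_scope.

Definition psi (R : realType) (q : R[i]) : R[i] :=
  qpoch (q ^+ 2) (q ^+ 2) / qpoch q (q ^+ 2).

(* Main.v *)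
Require Import Defs.
From mathcomp Require Import ring lra zify.

(** The idea is to read every quantity off one bilateral series,
    Phi_c(t) = \sum_(n in Z) c^n / (1 - t c^(2n)), for a nome c with |c| < 1.

    Product formula.  The function Phi_c is a quotient of theta products,
    psi^2(c) (ct; c^2) (c/t; c^2) / ((t; c^2) (c^2/t; c^2)).  It is the limit of a
    terminating partial fraction expansion ([finite_partial_fractions],
    [finite_bilateral]); Tannery's theorem ([tannery]) allows the passage to the
    limit ([cvg_bilateral_sum]).

    Square.  In the double series for t Phi_c(t)^2 the product of the terms of
    indices m <> n splits into two simple fractions, with a coefficient that
    depends only on n - m.  For a finite truncation these fractions regroup exactly
    ([sum_off_diagonal]), and the limit is the addition theorem
    t Phi_c(t)^2 = P(t) - P(c) with P(t) = \sum_(n in Z) X / (1 - X)^2 at X = t c^(2n)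
    ([bilateral_square]).

    Part (a) is c = q^3, t = w a primitive cube root of unity.  There
    (1 - w) Phi = psi^3(q^3) / psi(q^9), and pairing opposite indices in Phi and
    in P(w) - P(c) gives the two Lambert series.

    Part (b) is c = q^2, t = q: there the theta quotient is 1, Phi = psi^2(q^2), and
    q psi^4(q^2) = P(q) - P(q^2) is the sum of y (1 + y^2) / (1 - y^2)^2 over the
    odd powers y of q, which is the Lambert series after an exchange of sums.  To
    square it once more, differentiate the splitting of products twice at the half
    period t = c, where Phi vanishes: the off-diagonal terms then cancel and the diagonal gives
    the last series ([odd_square_sum_sqr]).

    The limits are taken in a numeric field where geometrically dominated series
    converge ([geometric_complete]); the complex numbers form such a field. *)

Set Implicit Arguments.
Unset Strict Implicit.
Unset Printing Implicit Defensive.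

Local Open Scope ring_scope.

(** * Finite sums over pairs and over symmetric ranges *)

Section Centered.
Variables (V : Type) (idx : V) (op : Monoid.com_law idx).
Implicit Types (g : nat -> V) (N : nat).

Lemma big_centered_odd g N : \big[op/idx]_(i < N.*2.+1) g i
  = op (g N) (\big[op/idx]_(k < N) op (g (N + k.+1)%N) (g (N - k.+1)%N)).
Proof.
rewrite -(big_mkord xpredT g) (@big_cat_nat _ _ _ N) /=; last 2 first.
- by [].
- lia.
rewrite [X in op _ X]big_ltn; last lia.
rewrite big_split /= Monoid.mulmC -Monoid.mulmA; congr (op _ (op _ _)).
  rewrite -(add0n N.+1) big_addn (_ : N.*2.+1 - N.+1 = N)%N; last lia.
  by rewrite big_mkord; apply: eq_bigr => i _; congr g; lia.
rewrite big_nat_rev /= big_mkord; apply: eq_bigr => i _.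
by congr g; rewrite add0n.
Qed.

Lemma big_centered_even g N : \big[op/idx]_(i < N.*2) g i
  = \big[op/idx]_(k < N) op (g (N + k)%N) (g (N - k.+1)%N).
Proof.
rewrite -(big_mkord xpredT g) (@big_cat_nat _ _ _ N) /=; last 2 first.
- by [].
- lia.
rewrite big_split /= Monoid.mulmC; congr (op _ _).
  rewrite -{1}(add0n N) big_addn (_ : N.*2 - N = N)%N; last lia.
  by rewrite big_mkord; apply: eq_bigr => i _; congr g; lia.
rewrite big_nat_rev /= big_mkord; apply: eq_bigr => i _.
by congr g; rewrite add0n.
Qed.

End Centered.

Lemma sum_symmetric (V : nmodType) (s : nat -> nat -> V) M :
    (forall i j, s i j = s j i) ->
  \sum_(i < M) \sum_(j < M) s i j
  = \sum_(i < M) s i i + (\sum_(j < M) \sum_(i < j) s i j) *+ 2.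
Proof.
move=> sC; elim: M => [|M IH]; first by rewrite !big_ord0 mul0rn addr0.
rewrite !big_ord_recr /=.
under eq_bigr do rewrite big_ord_recr /=.
rewrite big_split /= IH.
have -> : \sum_(j < M) s M j = \sum_(i < M) s i M by apply: eq_bigr => j _.
rewrite [in RHS]mulrnDl; set A := \sum_(i < M) s i i; set C := \sum_(i < M) s i M.
rewrite (mulr2n C) -!addrA; congr (A + _); rewrite [RHS]addrCA; congr (_ + _).
by rewrite [RHS]addrCA; congr (_ + _); rewrite addrA addrC.
Qed.

Lemma sqr_sum (V : comPzRingType) (g : nat -> V) M :
  (\sum_(i < M) g i) ^+ 2
  = \sum_(i < M) g i ^+ 2 + (\sum_(j < M) \sum_(i < j) g i * g j) *+ 2.
Proof.
rewrite expr2 big_distrlr /= (sum_symmetric M (s := fun i j => g i * g j))//.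
by move=> i j; rewrite mulrC.
Qed.

Section OffDiagonal.
Variables (V : comPzRingType) (e h : nat -> V).
Let W i := \sum_(d < i) e d.+1.

Lemma sum_rev (g : nat -> V) M : \sum_(i < M) g (M.-1 - i)%N = \sum_(i < M) g i.
Proof.
rewrite (reindex_inj rev_ord_inj); apply: eq_bigr => i _ /=.
by congr g; case: M i => [[]//|M i] /=; have := ltn_ord i; lia.
Qed.

(** Summing [e (j - i) * h i] over [i < j] groups the partial sums [W] of [e]
    behind each [h i]; the same grouping for [h j], read backwards, gives the
    difference with the mirror image.  The differences [h i - h (M.-1 - i)] add
    up to zero, so any constant [w] may be subtracted from the [W i]: with [w]
    the limit of [W], the coefficients [w - W i] decay and the sum can pass to
    the limit in [M]. *)
Lemma sum_off_diagonal M w :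
  \sum_(j < M) \sum_(i < j) e (j - i) * (h i - h j)
  = \sum_(i < M) (w - W i) * (h i - h (M.-1 - i)%N).
Proof.
have T1 : \sum_(j < M) \sum_(i < j) e (j - i) * h i
    = \sum_(i < M) h i * W (M.-1 - i)%N.
  elim: M => [|M IH]; first by rewrite !big_ord0.
  rewrite big_ord_recr IH [RHS]big_ord_recr /= subnn {3}/W big_ord0 mulr0 addr0.
  rewrite -big_split; apply: eq_bigr => i _ /=.
  have -> : (M - i = (M.-1 - i).+1)%N by have := ltn_ord i; lia.
  by rewrite {2}/W big_ord_recr /= mulrDr; congr (_ + _); rewrite mulrC.
have T2 : \sum_(j < M) \sum_(i < j) e (j - i) * h j = \sum_(j < M) h j * W j.
  apply: eq_bigr => j _; rewrite -mulr_suml mulrC; congr (_ * _).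
  rewrite /W -(sum_rev (fun d => e d.+1)); apply: eq_bigr => i _.
  by congr e; have := ltn_ord i; lia.
have R1 : \sum_(i < M) h (M.-1 - i)%N * W i = \sum_(i < M) h i * W (M.-1 - i)%N.
  rewrite -(sum_rev (fun i => h i * W (M.-1 - i)%N)); apply: eq_bigr => i _.
  by congr (_ * W _); have := ltn_ord i; lia.
transitivity (\sum_(i < M) h i * W (M.-1 - i)%N - \sum_(j < M) h j * W j).
  rewrite -T1 -T2 -sumrB; apply: eq_bigr => j _.
  by rewrite -sumrB; apply: eq_bigr => i _; rewrite mulrBr.
rewrite -R1 -sumrB.
transitivity (\sum_(i < M) ((w - W i) * (h i - h (M.-1 - i)%N) - (w * h i - w * h (M.-1 - i)%N))).
  by apply: eq_bigr => i _; ring.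
rewrite sumrB [X in _ - X]sumrB -!mulr_sumr (sum_rev h); ring.
Qed.

End OffDiagonal.

(** * Partial fractions and squares of truncated bilateral series *)

(** This is the ratio (c; c^2)_n / (c^2; c^2)_n, which tends to 1 / psi(c). *)
Definition odd_even_ratio (F : fieldType) (c : F) n :=
  \prod_(i < n) ((1 - c ^+ (i.*2.+1)) / (1 - c ^+ (i.*2.+2))).

Section FinitePartialFractions.
Variables (F : fieldType) (c : F).
Hypothesis c0 : c != 0.
Hypothesis c1 : forall k, c ^+ k.+1 != 1.
Local Notation u := (odd_even_ratio c).

Lemma oneBX_neq0 k : (0 < k)%N -> 1 - c ^+ k != 0.
Proof. by case: k => // k _; rewrite subr_eq0 eq_sym. Qed.

(** The terminating form of the product formula: the partial fraction
    expansion in [s] of a quotient of two finite q-factorials.  Going from [n] to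
    [n.+1] multiplies the left side by (1 - s c^(2n+1)) / (1 - s c^(2n+2)); each
    old pole keeps its place, and the residues at the new pole s = c^(-2n-2) add
    up to the induction hypothesis taken at that point, which is why the
    induction quantifies over [s]. *)
Lemma finite_partial_fractions n s : (forall i, (i <= n)%N -> 1 - s * c ^+ i.*2 != 0) ->
  \sum_(i < n.+1) u i * u (n - i)%N * c ^+ i / (1 - s * c ^+ i.*2)
  = (\prod_(j < n) (1 - s * c ^+ j.*2.+1)) / \prod_(j < n.+1) (1 - s * c ^+ j.*2).
Proof.
elim: n s => [|n IH] s hs.
  by rewrite !big_ord1 !big_ord0 /odd_even_ratio !big_ord0 !mulr1.
pose d := 1 - s * c ^+ n.+1.*2; have d0 : d != 0 by exact: hs.
pose s' := (c ^+ n.+1.*2)^-1.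
have hs' i : (i <= n)%N -> 1 - s' * c ^+ i.*2 != 0.
  move=> lin; have -> : s' * c ^+ i.*2 = (c ^+ (n.+1 - i).*2)^-1.
    rewrite /s'; have -> : (n.+1.*2 = (n.+1 - i).*2 + i.*2)%N by lia.
    by rewrite exprD invfM mulfVK// expf_neq0.
  rewrite subr_eq0 eq_sym invr_eq1.
  have -> : ((n.+1 - i).*2 = (n - i).*2.+1.+1)%N by lia.
  exact: c1.
(* Partial fractions in [s] of one summand: its own pole and the new one. *)
have split_term (i : 'I_n.+1) :
   u i * u (n.+1 - i)%N * c ^+ i / (1 - s * c ^+ i.*2)
   = u i * u (n - i)%N * c ^+ i / (1 - s * c ^+ i.*2) * (1 - s * c ^+ n.*2.+1) / d
     - (1 - c^-1) / d * (u i * u (n - i)%N * c ^+ i / (1 - s' * c ^+ i.*2)).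
  have lin : (i <= n)%N by rewrite -ltnS.
  have -> : (n.+1 - i = (n - i).+1)%N by lia.
  rewrite /odd_even_ratio [in LHS](big_ord_recr (n - i)) /= -/(odd_even_ratio c (n - i)) -/(odd_even_ratio c i).
  have h1 := hs i (leqW lin); have h2 := hs' _ lin.
  have h3 : 1 - c ^+ (n - i).*2.+2 != 0 by exact: oneBX_neq0.
  move: d0 h1 h2 h3; rewrite /d /s'.
  have -> : (n.*2.+1 = (n - i).*2.+1 + i.*2)%N by lia.
  have -> : (n.+1.*2 = (n - i).*2.+2 + i.*2)%N by lia.
  rewrite !exprD !(exprS c (n - i).*2.+1) (exprS c (n - i).*2).
  have x0 : c ^+ (n - i).*2 != 0 by rewrite expf_neq0.
  have y0 : c ^+ i.*2 != 0 by rewrite expf_neq0.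
  move: (c ^+ (n - i).*2) (c ^+ i.*2) (c ^+ i) (u i) (u (n - i)%N) x0 y0.
  move=> x y z a b x0 y0 d0 h1 h2 h3; field.
  rewrite c0 x0 y0 h1 d0 h3 /= andbT.
  move: h2; apply: contraNN => /eqP h.
  apply/eqP; transitivity ((c * (c * x) - 1) / (c * (c * x))); last by rewrite h mul0r.
  by field; rewrite c0 x0 y0.
rewrite big_ord_recr /= (eq_bigr _ (fun i _ => split_term i)) sumrB -!mulr_suml -mulr_sumr.
rewrite (IH s') // (IH s); last by move=> i lin; apply: hs; exact: leqW.
rewrite subnn.
(* The residue of the right-hand side at the new pole. *)
have key : \prod_(j < n) (1 - s' * c ^+ j.*2.+1) / \prod_(j < n.+1) (1 - s' * c ^+ j.*2)
    * (1 - c^-1) = c ^+ n.+1 * u n.+1.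
  have -> : 1 - c^-1 = 1 - s' * c ^+ n.*2.+1.
    by rewrite /s' doubleS exprS invfM mulfVK ?expf_neq0.
  rewrite mulrAC.
  have -> : (\prod_(j < n) (1 - s' * c ^+ j.*2.+1)) * (1 - s' * c ^+ n.*2.+1)
      = \prod_(j < n.+1) (1 - s' * c ^+ j.*2.+1) by rewrite big_ord_recr.
  rewrite -prodf_div (reindex_inj rev_ord_inj) /odd_even_ratio.
  transitivity (\prod_(j < n.+1) (c * ((1 - c ^+ j.*2.+1) / (1 - c ^+ j.*2.+2)))).
    apply: eq_bigr => j _ /=; have jn : (j <= n)%N by rewrite -ltnS.
    rewrite /s' subSS.
    have -> : (n.+1.*2 = j.*2.+2 + (n - j).*2)%N by lia.
    have h3 : 1 - c ^+ j.*2.+2 != 0 by exact: oneBX_neq0.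
    move: h3; rewrite exprS [c ^+ (n - j).*2.+1]exprS [c ^+ j.*2.+1]exprS.
    have x0 : c ^+ (n - j).*2 != 0 by rewrite expf_neq0.
    have y0 : c ^+ j.*2 != 0 by rewrite expf_neq0.
    rewrite exprD [c ^+ j.*2.+2]exprS [c ^+ j.*2.+1]exprS.
    move: (c ^+ (n - j).*2) (c ^+ j.*2) x0 y0 => x y x0 y0 h3; field.
    by rewrite c0 x0 y0 h3 -opprB oppr_eq0 h3.
  by rewrite big_split /= prodr_const card_ord.
rewrite (mulrAC (1 - c^-1)) [(1 - c^-1) * _]mulrC key.
rewrite [u 0]/odd_even_ratio big_ord0 [in RHS]big_ord_recr /=.
rewrite [\prod_(j < n.+2) _]big_ord_recr /= -/d.
move: (\prod_(j < n) _) (\prod_(j < n.+1) _) => x y.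
by rewrite invfM; ring.
Qed.
End FinitePartialFractions.

(** The terms of index [k.+1] and [-k.-1] of the series of c^n / (1 - t c^(2n))
    over all integers n, the second one cleared of negative powers of [c]. *)
Definition bilateral_term (F : fieldType) (c t : F) k :=
  c ^+ k.+1 / (1 - t * c ^+ k.+1.*2) + c ^+ k.+1 / (c ^+ k.+1.*2 - t).

Definition bilateral_sum (F : fieldType) (c t : F) N :=
  (1 - t)^-1 + \sum_(k < N) bilateral_term c t k.

(** The point t c^(2n) with n = i - N: the truncation |n| <= N becomes the
    range [i < N.*2.+1]. *)
Definition lattice_point (F : fieldType) (c t : F) N i :=
  t / c ^+ N.*2 * c ^+ i.*2.

Section Finite.
Variables (F : fieldType) (c t : F).
Hypothesis c0 : c != 0.
Hypothesis c1 : forall k, c ^+ k.+1 != 1.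
Hypothesis t1 : forall k, 1 - t * c ^+ k.*2 != 0.
Hypothesis t2 : forall k, c ^+ k.+1.*2 - t != 0.
Local Notation u := (odd_even_ratio c).

Let t0 : 1 - t != 0. Proof. by have := t1 0; rewrite expr0 mulr1. Qed.
Let cn k : c ^+ k != 0. Proof. by rewrite expf_neq0. Qed.

Lemma shift_up N m : t / c ^+ N.*2 * c ^+ (N.*2 + m) = t * c ^+ m.
Proof. by rewrite exprD mulrA divfK. Qed.

Lemma shift_down n m : t / c ^+ (n + m) * c ^+ n = t / c ^+ m.
Proof. by rewrite exprD; field; rewrite !cn. Qed.

Lemma shift_downE N m : (m <= N.*2)%N ->
  t / c ^+ N.*2 * c ^+ (N.*2 - m) = t / c ^+ m.
Proof. by move=> mN; rewrite -{1}(subnK mN) shift_down. Qed.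

Lemma oneB_shift_neq0 N i : 1 - t / c ^+ N.*2 * c ^+ i.*2 != 0.
Proof.
have [Ni|iN] := leqP N i.
  by rewrite -(subnKC Ni) doubleD shift_up.
have -> : (i.*2 = N.*2 - (N - i).-1.+1.*2)%N by lia.
rewrite shift_downE; last lia.
have := t2 (N - i).-1; apply: contraNN => /eqP h; apply/eqP.
by rewrite -(mulr0 (c ^+ (N - i).-1.+1.*2)) -h; field.
Qed.

(** [finite_partial_fractions] with an even number of factors, recentred at
    s = t c^(-2N) so that both tails of the index grow with [N]. *)
Lemma finite_bilateral N :
  u N ^+ 2 / (1 - t) + \sum_(k < N) u (N + k.+1)%N * u (N - k.+1)%N * bilateral_term c t k
  = (1 - t)^-1 * \prod_(j < N) ((1 - t * c ^+ j.*2.+1) * (c ^+ j.*2.+1 - t)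
       / ((1 - t * c ^+ j.+1.*2) * (c ^+ j.+1.*2 - t))).
Proof.
have := finite_partial_fractions c0 c1 (n := N.*2) (s := t / c ^+ N.*2)
  (fun i _ => oneB_shift_neq0 N i).
rewrite (big_centered_odd _ (fun i => u i * u (N.*2 - i)%N * c ^+ i / (1 - t / c ^+ N.*2 * c ^+ i.*2))).
rewrite (big_centered_odd _ (fun j => 1 - t / c ^+ N.*2 * c ^+ j.*2)).
rewrite (big_centered_even _ (fun j => 1 - t / c ^+ N.*2 * c ^+ j.*2.+1)) /=.
move=> h; apply: (mulfI (cn N)).
transitivity (u N * u (N.*2 - N)%N * c ^+ N / (1 - t / c ^+ N.*2 * c ^+ N.*2) +
    \sum_(k < N)
       (u (N + k.+1)%N * u (N.*2 - (N + k.+1))%N * c ^+ (N + k.+1) /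
        (1 - t / c ^+ N.*2 * c ^+ (N + k.+1).*2) +
        u (N - k.+1)%N * u (N.*2 - (N - k.+1))%N * c ^+ (N - k.+1) /
        (1 - t / c ^+ N.*2 * c ^+ (N - k.+1).*2))).
  rewrite mulrDr mulr_sumr; congr (_ + _).
    have -> : (N.*2 - N = N)%N by lia.
    by rewrite divfK//; move: (c ^+ N) (u N) => x a; field.
  apply: eq_bigr => k _; have kN := ltn_ord k.
  have -> : (N.*2 - (N + k.+1) = N - k.+1)%N by lia.
  have -> : (N.*2 - (N - k.+1) = N + k.+1)%N by lia.
  rewrite doubleD shift_up doubleB shift_downE; last lia.
  have cN : c ^+ N = c ^+ k.+1 * c ^+ (N - k.+1) by rewrite -exprD subnKC.
  rewrite /bilateral_term exprD cN.
  have e1 := t1 k.+1; have e2 := t2 k.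
  have := cn k.+1; have := cn (N - k.+1)%N; move: e1 e2.
  rewrite -addnn exprD.
  move: (c ^+ k.+1) (c ^+ (N - k.+1)) => x y e1 e2 y0 x0; field.
  by rewrite e1 e2 x0.
rewrite h {h} divfK// invfM -prodfV.
rewrite mulrCA [in RHS]mulrCA; congr (_ * _).
have -> : c ^+ N = \prod_(k < N) c by rewrite prodr_const card_ord.
rewrite -!big_split; apply: eq_bigr => k _ /=; have kN := ltn_ord k.
have -> : ((N + k).*2.+1 = N.*2 + k.*2.+1)%N by lia.
have -> : ((N + k.+1).*2 = N.*2 + k.+1.*2)%N by lia.
have -> : ((N - k.+1).*2.+1 = N.*2 - k.*2.+1)%N by lia.
have -> : ((N - k.+1).*2 = N.*2 - k.+1.*2)%N by lia.
rewrite !shift_up !shift_downE; try lia.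
have -> : k.+1.*2 = k.*2.+2 by lia.
have := t1 k.+1; have := t2 k; rewrite doubleS (exprS c k.*2.+1).
have := cn k.*2.+1; move: (c ^+ k.*2.+1) => x x0 e2 e1; field.
by rewrite c0 x0 e1 e2.
Qed.

Local Notation X := (lattice_point c t).

(** The square of the truncated bilateral series.  For two indices at distance
    d, the points X and X c^(2d) are in a ratio that depends on d only, so that
    X c^d / ((1 - X) (1 - X c^(2d)))
      = c^d / (1 - c^(2d)) * (X / (1 - X) - X c^(2d) / (1 - X c^(2d)))
    splits each off-diagonal product into the shape of [sum_off_diagonal]. *)
Lemma sqr_bilateral_sum N w :
  t * bilateral_sum c t N ^+ 2
  = (t / (1 - t) ^+ 2 + \sum_(k < N) (t * c ^+ k.+1.*2 / (1 - t * c ^+ k.+1.*2) ^+ 2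
       + t * c ^+ k.+1.*2 / (c ^+ k.+1.*2 - t) ^+ 2))
  + (\sum_(i < N.*2.+1) (w - \sum_(d < i) c ^+ d.+1 / (1 - c ^+ d.+1.*2))
      * (X N i / (1 - X N i) - X N (N.*2 - i)%N / (1 - X N (N.*2 - i)%N))) *+ 2.
Proof.
pose f i := c ^+ i / c ^+ N / (1 - X N i).
have X1 i : 1 - X N i != 0 by exact: oneB_shift_neq0.
have XE i : X N i = t / c ^+ N ^+ 2 * c ^+ i ^+ 2.
  by rewrite /lattice_point -!exprM !muln2.
have XN : X N N = t by rewrite /lattice_point divfK.
have Xp k : X N (N + k)%N = t * c ^+ k.*2 by rewrite /lattice_point doubleD shift_up.
have Xm k : (k <= N)%N -> X N (N - k)%N = t / c ^+ k.*2.
  by move=> kN; rewrite /lattice_point doubleB shift_downE//; lia.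
have Sf : bilateral_sum c t N = \sum_(i < N.*2.+1) f i.
  rewrite (big_centered_odd _ f) /= /f divff// XN mul1r; congr (_ + _).
  apply: eq_bigr => k _; have kN := ltn_ord k.
  have cN : c ^+ N = c ^+ k.+1 * c ^+ (N - k.+1) by rewrite -exprD subnKC.
  rewrite Xp Xm// /bilateral_term exprD cN.
  have e1 := t1 k.+1; have e2 := t2 k.
  have := cn k.+1; have := cn (N - k.+1)%N; move: e1 e2.
  rewrite -addnn exprD.
  move: (c ^+ k.+1) (c ^+ (N - k.+1)) => x y e1 e2 y0 x0; field.
  by rewrite x0 e2 y0 e1.
rewrite Sf sqr_sum mulrDr mulrnAr; congr (_ + _ *+ 2).
  rewrite mulr_sumr.
  transitivity (\sum_(i < N.*2.+1) (fun i => X N i / (1 - X N i) ^+ 2) i).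
    apply: eq_bigr => i _; rewrite /f; have := X1 i; rewrite {3}XE; have := cn N.
    move: (c ^+ i) (c ^+ N) (1 - X N i) => x z d z0 d0; field.
    by rewrite z0 d0.
  rewrite (big_centered_odd _ (fun i => X N i / (1 - X N i) ^+ 2)) /= XN; congr (_ + _).
  apply: eq_bigr => k _; have kN := ltn_ord k.
  rewrite Xp Xm//.
  have e1 := t1 k.+1; have e2 := t2 k; have := cn k.+1.*2; move: e1 e2.
  move: (c ^+ k.+1.*2) => x e1 e2 x0; field.
  by rewrite e1 e2 x0.
rewrite mulr_sumr.
rewrite -(sum_off_diagonal (fun d => c ^+ d / (1 - c ^+ d.*2)) (fun i => X N i / (1 - X N i))).
apply: eq_bigr => j _; rewrite mulr_sumr; apply: eq_bigr => i _.
have ij : (i <= j)%N by exact: ltnW.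
have Xj : X N j = X N i * c ^+ (j - i).*2.
  by rewrite /lattice_point -[RHS]mulrA -exprD -doubleD subnKC.
have d1 : 1 - c ^+ (j - i).*2 != 0.
  by apply: oneBX_neq0 => //; have := ltn_ord i; lia.
have cj : c ^+ j = c ^+ i * c ^+ (j - i) by rewrite -exprD subnKC.
rewrite /f Xj cj.
transitivity (X N i * c ^+ (j - i) / ((1 - X N i) * (1 - X N i * c ^+ (j - i).*2))).
  have ht : t = X N i * c ^+ N ^+ 2 / c ^+ i ^+ 2.
    by rewrite XE; have := cn N; have := cn i; move=> x0 z0; field; rewrite x0 z0.
  rewrite {1}ht; have := X1 j; have := X1 i; rewrite Xj; have := cn N; have := cn i.
  move: (X N i) (c ^+ i) (c ^+ N) (1 - X N i * _) (1 - X N i) => y x z b a x0 z0 a0 b0.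
  by field; rewrite x0 z0 a0 b0.
move: d1 (X1 i) (X1 j); rewrite Xj -muln2 exprM.
move: (c ^+ (j - i)) (X N i) => d x e1 e2 e3; field.
by rewrite e1 e2 e3.
Qed.
End Finite.

(** * Geometrically dominated series *)

(** Completeness in the only form needed: geometrically dominated series
    converge. *)
Definition geometric_complete (K : numFieldType) : Prop :=
  forall (u : nat -> K) (C r : K), 0 <= r -> r < 1 ->
    (forall n, `|u n| <= C * r ^+ n) ->
  exists l : K, ((fun N => \sum_(n < N) u n) @ \oo --> l)%classic.

Section Tannery.
Local Open Scope classical_set_scope.
Variable K : numFieldType.
Hypothesis Kc : geometric_complete K.
Implicit Types (u : nat -> K) (f : nat -> nat -> K) (C r : K).

Lemma cvg_expn0 r : 0 <= r -> r < 1 -> (fun n => r ^+ n) @ \oo --> 0.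
Proof.
move=> r0 r1.
have [n|l hl] := @Kc (fun n => r ^+ n) 1 r r0 r1.
  by rewrite mul1r ger0_norm ?exprn_ge0.
have hS : (fun n => \sum_(k < n.+1) r ^+ k) @ \oo --> l.
  by move: hl; rewrite -(cvg_shiftS (fun N => \sum_(n < N) r ^+ n)).
have -> : (0 : K) = l - l by rewrite subrr.
have -> : (fun n => r ^+ n)
    = (fun n => \sum_(k < n.+1) r ^+ k - \sum_(k < n) r ^+ k).
  by apply/funext => n; rewrite big_ord_recr /= addrAC subrr add0r.
exact: cvgB.
Qed.

Lemma geometric_sum_le r m n : 0 <= r -> r < 1 ->
  \sum_(m <= k < n) r ^+ k <= r ^+ m / (1 - r).
Proof.
move=> r0 r1; have d0 : 0 < 1 - r by rewrite subr_gt0.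
have [nm|mn] := leqP n m.
  by rewrite big_geq// divr_ge0 ?exprn_ge0// ltW.
rewrite ler_pdivlMr//.
suff -> : (\sum_(m <= k < n) r ^+ k) * (1 - r) = r ^+ m - r ^+ n.
  by rewrite gerBl exprn_ge0.
rewrite mulr_suml -(opprB (r ^+ n)) -(telescope_sumr (fun k => r ^+ k) (ltnW mn)).
by rewrite -sumrN; apply: eq_bigr => k _; rewrite exprS; ring.
Qed.

(** A head of fixed length tends to zero termwise, and the geometric tail is
    small uniformly in [N]; the number [M N] of summands is arbitrary. *)
Lemma cvg_sum0_geometric f C r (M : nat -> nat) : 0 <= r -> r < 1 ->
    (forall N n, `|f N n| <= C * r ^+ n) ->
    (forall n, f ^~ n @ \oo --> 0) ->
  (fun N => \sum_(n < M N) f N n) @ \oo --> 0.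
Proof.
move=> r0 r1 hf f0; have d0 : 0 < 1 - r by rewrite subr_gt0.
have C0 : 0 <= C by have := hf 0 0; rewrite expr0 mulr1; apply: le_trans.
have tail0 : (fun k => C * (r ^+ k / (1 - r))) @ \oo --> 0.
  rewrite -(mulr0 C) -(mul0r (1 - r)^-1).
  by apply: cvgMr; apply: cvgMl; exact: cvg_expn0.
apply/cvgr0Pnorm_le => e e0.
have e20 : 0 < e / 2%:R by rewrite divr_gt0.
have [k _ /(_ k (leqnn k)) hk] := (cvgr0Pnorm_le _).1 tail0 _ e20.
have head0 : (fun N => \sum_(n < k) `|f N n|) @ \oo --> 0.
  elim: (k) => [|j IHj].
    by under eq_fun do rewrite big_ord0; exact: cvg_cst.
  under eq_fun do rewrite big_ord_recr.
  have := cvgD IHj (cvg_norm (f0 j)).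
  rewrite normr0 addr0; exact.
near=> N.
have hN : `| \sum_(n < k) `|f N n| | <= e / 2%:R.
  by near: N; exact: (cvgr0Pnorm_le _).1 head0 _ e20.
have hk' : C * (r ^+ k / (1 - r)) <= e / 2%:R.
  by apply: le_trans hk; rewrite ger0_norm// mulr_ge0// divr_ge0 ?exprn_ge0// ltW.
have {}hN : \sum_(n < k) `|f N n| <= e / 2%:R.
  by apply: le_trans hN; rewrite ger0_norm// sumr_ge0.
rewrite (splitr e); apply: le_trans (lerD hN hk').
apply: le_trans (ler_norm_sum _ _ _) _.
rewrite -!(big_mkord xpredT (fun n => `|f N n|)).
have h1 : \sum_(0 <= n < M N) `|f N n| <= \sum_(0 <= n < maxn k (M N)) `|f N n|.
  rewrite (@big_cat_nat _ _ _ (M N) 0 (maxn k (M N)))//= ?leq_maxr//.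
  by rewrite lerDl sumr_ge0.
apply: le_trans h1 _.
rewrite (@big_cat_nat _ _ _ k 0 (maxn k (M N)))//= ?leq_maxl//.
rewrite lerD2l. apply: (le_trans _ (ler_wpM2l C0 (geometric_sum_le k (maxn k (M N)) r0 r1))).
by rewrite mulr_sumr; apply: ler_sum => n _; exact: hf.
Unshelve. all: by end_near.
Qed.

Lemma norm_lim_le (u : nat -> K) l C :
  u @ \oo --> l -> (forall n, `|u n| <= C) -> `|l| <= C.
Proof.
move=> ul uC; have nul : (fun n => `|u n|) @ \oo --> `|l| by exact: cvg_norm.
have Cr : C \is Num.real by apply: ger0_real; apply: le_trans (uC 0%N).
apply/ler_addgt0Pr => e e0.
have [k _ /(_ k (leqnn k)) hk] := (cvgrPdist_le _ _).1 ul _ e0.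
rewrite -(subrK (u k) l) addrC; apply: le_trans (ler_normD _ _) _.
by apply: lerD.
Qed.

(** Tannery's theorem: dominated convergence for sums whose terms and whose
    number of terms both depend on [N]. *)
Lemma tannery f (g : nat -> K) C r (M : nat -> nat) : 0 <= r -> r < 1 ->
    (forall N n, `|f N n| <= C * r ^+ n) ->
    (forall n, f ^~ n @ \oo --> g n) -> M @ \oo --> \oo ->
  exists2 l : K, (fun N => \sum_(n < N) g n) @ \oo --> l
           & (fun N => \sum_(n < M N) f N n) @ \oo --> l.
Proof.
move=> r0 r1 hf fg hM.
have hg n : `|g n| <= C * r ^+ n.
  by apply: norm_lim_le (fg n) _ => N; exact: hf.
have [l hl] := @Kc _ _ _ r0 r1 hg; exists l => //.
have h0 : (fun N => \sum_(n < M N) (f N n - g n)) @ \oo --> 0.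
  apply: (@cvg_sum0_geometric (fun N n => f N n - g n) (C + C) r) => //.
    move=> N n; rewrite mulrDl; apply: le_trans (ler_normB _ _) _; exact: lerD.
  by move=> n; rewrite -(subrr (g n)); apply: cvgB => //; exact: cvg_cst.
have hgM : (fun N => \sum_(n < M N) g n) @ \oo --> l.
  by apply: (cvg_comp M (fun N => \sum_(n < N) g n) hM hl).
have -> : (fun N => \sum_(n < M N) f N n) =
   (fun N => \sum_(n < M N) (f N n - g n) + \sum_(n < M N) g n).
  by apply/funext => N; rewrite -big_split; apply: eq_bigr => n _; rewrite /= subrK.
by rewrite -(add0r l); apply: cvgD.
Qed.

Lemma norm_sum_geometric_le (v : nat -> K) C r N : 0 <= r -> r < 1 ->
    (forall k, `|v k| <= C * r ^+ k) ->
  `|\sum_(k < N) v k| <= C / (1 - r).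
Proof.
move=> r0 r1 hv; apply: le_trans (ler_norm_sum _ _ _) _.
have C0 : 0 <= C by have := hv 0; rewrite expr0 mulr1; apply: le_trans.
apply: (@le_trans _ _ (C * \sum_(0 <= k < N) r ^+ k)).
  by rewrite big_mkord mulr_sumr; apply: ler_sum => k _.
apply: ler_wpM2l => //.
by apply: le_trans (geometric_sum_le 0 N r0 r1) _; rewrite expr0 mul1r.
Qed.

(** Both iterated sums are the limit of the sums over the squares
    [n, k < N]. *)
Lemma exchange_series (a : nat -> nat -> K) (b c : nat -> K) C r :
    0 <= r -> r < 1 -> (forall n k, `|a n k| <= C * r ^+ n * r ^+ k) ->
    (forall n, (fun N => \sum_(k < N) a n k) @ \oo --> b n) ->
    (forall k, (fun N => \sum_(n < N) a n k) @ \oo --> c k) ->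
  exists2 l : K, (fun N => \sum_(n < N) b n) @ \oo --> l
           & (fun N => \sum_(k < N) c k) @ \oo --> l.
Proof.
move=> r0 r1 ha hb hc.
have hM : (fun n : nat => n) @ \oo --> \oo by exact: cvg_id.
have rows N n : `|\sum_(k < N) a n k| <= C / (1 - r) * r ^+ n.
  by rewrite mulrAC; exact: (norm_sum_geometric_le _ r0 r1 (ha n)).
have cols N k : `|\sum_(n < N) a n k| <= C / (1 - r) * r ^+ k.
  rewrite mulrAC; apply: (@norm_sum_geometric_le (a ^~ k) (C * r ^+ k) r N r0 r1) => n.
  by rewrite mulrAC.
have [l hl hl'] := tannery (f := fun N n => \sum_(k < N) a n k) r0 r1 rows hb hM.
have [l2 h2 h2'] := tannery (f := fun N k => \sum_(n < N) a n k) r0 r1 cols hc hM.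
exists l => //; suff -> : l = l2 by [].
apply: (cvg_unique (@norm_hausdorff _ _) hl').
suff -> : (fun N => \sum_(n < N) \sum_(k < N) a n k) =
  (fun N => \sum_(n < N) \sum_(k < N) a k n) by [].
by apply/funext => N; rewrite exchange_big.
Qed.

End Tannery.

(** * Infinite products *)

Section Prod.
Local Open Scope classical_set_scope.
Variable K : numFieldType.
Hypothesis Kc : geometric_complete K.

(** Past an index where the remaining terms add up to at most 1/2, a product of
    factors 1 + x_i is at most 1 + 2 * \sum x_i, hence at most 2.  This avoids the
    exponential, which an arbitrary numeric field does not have. *)
Lemma prod1D_bounded (C r : K) : 0 <= C -> 0 <= r -> r < 1 ->
  exists B, forall n, \prod_(i < n) (1 + C * r ^+ i) <= B.
Proof.
move=> C0 r0 r1; have d0 : 0 < 1 - r by rewrite subr_gt0.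
pose x i := C * r ^+ i; have x0 i : 0 <= x i by rewrite mulr_ge0 ?exprn_ge0.
pose P n := \prod_(i < n) (1 + x i).
have PS n : P n.+1 = P n * (1 + x n) by rewrite /P big_ord_recr.
have P0 n : 0 <= P n by apply: prodr_ge0 => i _; rewrite addr_ge0.
have tail0 : (fun k => C * (r ^+ k / (1 - r))) @ \oo --> 0.
  rewrite -(mulr0 C) -(mul0r (1 - r)^-1).
  by apply: cvgMr; apply: cvgMl; exact: cvg_expn0.
have h20 : 0 < 2%:R^-1 :> K by rewrite invr_gt0.
have [k _ /(_ k (leqnn k)) hk] := (cvgr0Pnorm_le _).1 tail0 _ h20.
have S_le m : \sum_(k <= i < k + m) x i <= 2%:R^-1.
  apply: le_trans hk; rewrite ger0_norm; last first.
    by rewrite mulr_ge0// divr_ge0 ?exprn_ge0// ltW.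
  by rewrite -mulr_sumr; apply: ler_wpM2l => //; exact: geometric_sum_le.
have le_P m : P (k + m)%N <= P k * (1 + 2%:R * \sum_(k <= i < k + m) x i).
  elim: m => [|m IH]; first by rewrite addn0 big_geq// mulr0 addr0 mulr1.
  rewrite addnS PS big_nat_recr ?leq_addr//=.
  apply: le_trans (ler_wpM2r _ IH) _; first by rewrite addr_ge0.
  rewrite -mulrA; apply: ler_wpM2l => //.
  set S := \sum_(_ <= _ < _) _.
  have -> : (1 + 2%:R * S) * (1 + x (k + m)%N) =
     1 + 2%:R * S + x (k + m)%N * (1 + 2%:R * S) by ring.
  rewrite [in leRHS]mulrDr [leRHS]addrA lerD2l mulrC; apply: ler_wpM2r => //.
  rewrite -[leRHS]/(1 + 1) lerD2l.
  by rewrite mulrC -ler_pdivlMr// mul1r; exact: S_le.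
exists (P k * 2%:R) => n.
have mono m : P n <= P (n + m)%N.
  elim: m => [|m IH]; first by rewrite addn0.
  by rewrite addnS PS; apply: le_trans IH _; rewrite ler_peMr// lerDl.
apply: le_trans (mono k) _; rewrite addnC; apply: le_trans (le_P n) _.
apply: ler_wpM2l => //; rewrite -[leRHS]/(1 + 1) lerD2l.
by rewrite mulrC -ler_pdivlMr// mul1r; exact: S_le.
Qed.

(** The increments of the partial products are dominated by the geometric
    sequence times the bound of the products. *)
Lemma cvg_prod1D (b : nat -> K) (C r : K) : 0 <= r -> r < 1 ->
    (forall n, `|b n| <= C * r ^+ n) ->
  exists l B : K, (fun n => \prod_(i < n) (1 + b i)) @ \oo --> l /\
    forall n, `|\prod_(i < n) (1 + b i)| <= B.
Proof.
move=> r0 r1 hb.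
have C0 : 0 <= C by have := hb 0; rewrite expr0 mulr1; apply: le_trans.
have [B hB] := prod1D_bounded C0 r0 r1.
pose P n := \prod_(i < n) (1 + b i).
have PB n : `|P n| <= B.
  apply: le_trans (hB n); rewrite normr_prod; apply: ler_prod => i _.
  rewrite normr_ge0 /=; apply: le_trans (ler_normD _ _) _.
  by rewrite normr1 lerD2l.
have [n|l hl] := @Kc (fun n => b n * P n) (C * B) r r0 r1.
  by rewrite normrM mulrAC; apply: ler_pM.
exists (1 + l), B; split=> //.
have -> : (fun n => \prod_(i < n) (1 + b i)) =
    (fun N => 1 + \sum_(n < N) b n * P n).
  apply/funext; elim=> [|n IH]; first by rewrite !big_ord0 addr0.
  by rewrite big_ord_recr /= IH big_ord_recr /= addrA -IH /P; ring.
by apply: cvgD => //; exact: cvg_cst.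
Qed.

Lemma norm_1B_ge (x y : K) : `|x| <= y -> 1 - y <= `|1 - x|.
Proof.
move=> xy; rewrite lerBlDr; apply: le_trans (_ : `|1 - x| + `|x| <= _).
  by rewrite -{1}(normr1 K) -{1}(subrK x 1); exact: ler_normD.
by rewrite lerD2l.
Qed.

(** The inverse factors are again of the form 1 + O(q^i), so their product
    converges too, which makes the limit nonzero. *)
Lemma cvg_qpoch (a q : K) : `|a| < 1 -> `|q| < 1 ->
  exists L B : K, [/\ L != 0,
    (fun n => \prod_(i < n) (1 - a * q ^+ i)) @ \oo --> L,
    forall n, `|\prod_(i < n) (1 - a * q ^+ i)| <= B &
    forall n, `|(\prod_(i < n) (1 - a * q ^+ i))^-1| <= B].
Proof.
move=> a1 q1; have d0 : 0 < 1 - `|a| by rewrite subr_gt0.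
have aq i : `|a * q ^+ i| <= `|a|.
  by rewrite normrM normrX ler_piMr// exprn_ile1// ltW.
have nz i : `|1 - a * q ^+ i| >= 1 - `|a| by exact: norm_1B_ge.
have nz' i : 1 - a * q ^+ i != 0.
  by rewrite -normr_gt0; exact: lt_le_trans (nz i).
have [n|L [B [hL hB]]] := @cvg_prod1D (fun i => - (a * q ^+ i)) `|a| `|q| (normr_ge0 _) q1.
  by rewrite normrN normrM normrX.
have [n|L' [B' [hL' hB']]] := @cvg_prod1D (fun i => a * q ^+ i / (1 - a * q ^+ i))
    (`|a| / (1 - `|a|)) `|q| (normr_ge0 _) q1.
  rewrite normrM normrM normrX mulrAC; apply: ler_wpM2r; first by rewrite exprn_ge0.
  by apply: ler_wpM2l => //; rewrite normfV lef_pV2// posrE normr_gt0.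
have inv n : \prod_(i < n) (1 + a * q ^+ i / (1 - a * q ^+ i)) =
    (\prod_(i < n) (1 - a * q ^+ i))^-1.
  rewrite -prodfV; apply: eq_bigr => i _.
  by rewrite -{1}(divff (nz' i)) -mulrDl subrK mul1r.
have LL' : L * L' = 1.
  have h : (fun n => (\prod_(i < n) (1 - a * q ^+ i)) *
      \prod_(i < n) (1 + a * q ^+ i / (1 - a * q ^+ i))) @ \oo --> L * L'.
    exact: cvgM.
  apply: (cvg_unique (@norm_hausdorff _ _) h).
  suff -> : (fun n => (\prod_(i < n) (1 - a * q ^+ i)) *
      \prod_(i < n) (1 + a * q ^+ i / (1 - a * q ^+ i))) = (fun=> 1).
    exact: cvg_cst.
  by apply/funext => n; rewrite inv divff//; apply/prodf_neq0.
exists L, (B + B'); split=> //.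
- by apply/eqP => L0; move: LL'; rewrite L0 mul0r => /esym/eqP; rewrite oner_eq0.
- by move=> n; apply: le_trans (hB n) _; rewrite lerDl; apply: le_trans (hB' 0).
- move=> n; rewrite -inv; apply: le_trans (hB' n) _.
  by rewrite lerDr; apply: le_trans (hB 0).
Qed.

End Prod.

(** * Tails of a Lambert series *)

Section Limits.
Local Open Scope classical_set_scope.
Variable K : numFieldType.
Hypothesis Kc : geometric_complete K.
Variable c : K.
Hypothesis c0 : c != 0.
Hypothesis c1 : `|c| < 1.
Local Notation r := (`|c|).

Lemma normX_lt1 k : `|c ^+ k.+1| < 1.
Proof. by rewrite normrX exprn_ilt1. Qed.

Lemma expn_neq1 k : c ^+ k.+1 != 1.
Proof.
by apply/eqP => h; have := normX_lt1 k; rewrite h normr1 ltxx.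
Qed.

Lemma norm_1BX_ge m : 1 - r <= `|1 - c ^+ m.+1|.
Proof. by apply: norm_1B_ge; rewrite normrX exprS ler_piMr// exprn_ile1// ltW. Qed.

Lemma cvgX0 (x : K) : `|x| < 1 -> (fun n => x ^+ n) @ \oo --> 0.
Proof.
move=> x1; apply/norm_cvg0P.
have -> : (fun n => `|x ^+ n|) = (fun n => `|x| ^+ n).
  by apply/funext => n; rewrite normrX.
exact: (cvg_expn0 Kc).
Qed.

Lemma geometric_series (x : K) : `|x| < 1 ->
  (fun N => \sum_(k < N) x ^+ k) @ \oo --> (1 - x)^-1.
Proof.
move=> x1.
have hx : 1 - x != 0.
  by rewrite subr_eq0; apply/eqP => h; move: x1; rewrite -h normr1 ltxx.
have xn0 := cvgX0 x1.
have -> : (fun N => \sum_(k < N) x ^+ k) = (fun N => (1 - x ^+ N) / (1 - x)).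
  apply/funext => N; apply: (mulIf hx); rewrite divfK//.
  by rewrite -[RHS]opprB subrX1 -mulNr opprB mulrC.
have h : (fun N => (1 - x ^+ N) / (1 - x)) @ \oo --> (1 - 0) / (1 - x).
  by apply: cvgMl; apply: cvgB => //; exact: cvg_cst.
by move: h; rewrite subr0 mul1r.
Qed.

(** The tails tau_i = \sum_(d > i) c^d / (1 - c^(2d)), written as
    \sum_m c^((i+1) m) / (1 - c^m) over odd m: consecutive tails then differ by a
    geometric series, and summing the tails over i by exchanging the two sums
    gives \sum_m c^m / (1 - c^m)^2. *)
Lemma lambert_tails : exists (tau : nat -> K) (E C : K),
  [/\ forall i, `|tau i| <= C * r ^+ i,
      forall i, tau 0 - \sum_(d < i) c ^+ d.+1 / (1 - c ^+ d.+1.*2) = tau i,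
      (fun N => \sum_(i < N) tau i) @ \oo --> E &
      (fun N => \sum_(k < N) c ^+ k.*2.+1 / (1 - c ^+ k.*2.+1) ^+ 2) @ \oo --> E].
Proof.
have d0 : 0 < 1 - r by rewrite subr_gt0.
pose a i k := c ^+ (i.+1 * k.*2.+1) / (1 - c ^+ k.*2.+1).
have ha i k : `|a i k| <= (1 - r)^-1 * r ^+ i * r ^+ k.
  rewrite normrM normfV mulrC -mulrA; apply: ler_pM; rewrite ?invr_ge0//.
    by rewrite lef_pV2 ?norm_1BX_ge// posrE; apply: lt_le_trans d0 (norm_1BX_ge _).
  have hik : (i + k <= i.+1 * k.*2.+1)%N by nia.
  by rewrite normrX -exprD; apply: ler_wiXn2l => //; exact: ltW.
have row i : exists b : K, (fun N => \sum_(k < N) a i k) @ \oo --> b.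
  exact: (@Kc (a i) _ _ (normr_ge0 c) c1 (ha i)).
have [tau htau] := choice row.
have col k : (fun N => \sum_(i < N) a i k) @ \oo --> c ^+ k.*2.+1 / (1 - c ^+ k.*2.+1) ^+ 2.
  have -> : (fun N => \sum_(i < N) a i k) = (fun N =>
     (c ^+ k.*2.+1 / (1 - c ^+ k.*2.+1)) * \sum_(i < N) (c ^+ k.*2.+1) ^+ i).
    apply/funext => N; rewrite mulr_sumr; apply: eq_bigr => i _.
    by rewrite /a mulnC exprM exprS; ring.
  rewrite expr2 invfM mulrA.
  by apply: cvgMr; apply: geometric_series; exact: normX_lt1.
have [E hE1 hE2] := exchange_series Kc (normr_ge0 c) c1 ha htau col.
exists tau, E, ((1 - r)^-1 / (1 - r)); split => //.
- move=> i; apply: norm_lim_le (htau i) _ => N.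
  by rewrite mulrAC; apply: norm_sum_geometric_le => //; exact: ha.
- elim=> [|i IH]; first by rewrite big_ord0 subr0.
  rewrite big_ord_recr /= opprD addrA IH; apply/eqP; rewrite subr_eq addrC -subr_eq; apply/eqP.
  have h : (fun N => \sum_(k < N) a i k - \sum_(k < N) a i.+1 k) @ \oo --> tau i - tau i.+1.
    by apply: cvgB.
  apply: (cvg_unique (@norm_hausdorff _ _) h).
  have -> : (fun N => \sum_(k < N) a i k - \sum_(k < N) a i.+1 k) =
     (fun N => c ^+ i.+1 * \sum_(k < N) (c ^+ i.+1.*2) ^+ k).
    apply/funext => N; rewrite -sumrB mulr_sumr; apply: eq_bigr => k _.
    rewrite /a (mulSn i.+1) exprD -mulrBl -{1}(mul1r (c ^+ (i.+1 * _))) -mulrBl mulrAC.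
    rewrite divff ?mul1r; last by rewrite subr_eq0 eq_sym expn_neq1.
    by rewrite -exprM -exprD; congr (c ^+ _); lia.
  by apply: cvgMr; apply: geometric_series; exact: normX_lt1.
Qed.

End Limits.

(** * The bilateral series: product formula and square *)

Section Bilateral.
Local Open Scope classical_set_scope.
Variable K : numFieldType.
Hypothesis Kc : geometric_complete K.
Variables c t : K.
Hypothesis c0 : c != 0.
Hypothesis c1 : `|c| < 1.
Hypothesis ct : `|c| ^+ 2 < `|t|.
Hypothesis t_le1 : `|t| <= 1.
Hypothesis t_neq1 : t != 1.
Local Notation r := (`|c|).
Local Notation u := (odd_even_ratio c).

Let r2 : 0 < 1 - r ^+ 2. Proof. by rewrite subr_gt0 exprn_ilt1. Qed.
Let rt : 0 < `|t| - r ^+ 2. Proof. by rewrite subr_gt0. Qed.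

Let cX2 k : `|c ^+ k.+1.*2| <= r ^+ 2.
Proof. by rewrite normrX doubleS -addn2 exprD ler_piMl// exprn_ile1// ltW. Qed.

Lemma right_pole_ge k : 1 - r ^+ 2 <= `|1 - t * c ^+ k.+1.*2|.
Proof.
apply: norm_1B_ge; rewrite normrM; apply: le_trans (cX2 k).
by rewrite ler_piMl.
Qed.

Lemma left_pole_ge k : `|t| - r ^+ 2 <= `|c ^+ k.+1.*2 - t|.
Proof.
rewrite distrC lerBlDr.
apply: le_trans (_ : `|t - c ^+ k.+1.*2| + `|c ^+ k.+1.*2| <= _).
  by rewrite -{1}(subrK (c ^+ k.+1.*2) t); exact: ler_normD.
by rewrite lerD2l.
Qed.

Lemma right_pole_neq0 k : 1 - t * c ^+ k.*2 != 0.
Proof.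
case: k => [|k]; first by rewrite expr0 mulr1 subr_eq0 eq_sym.
by rewrite -normr_gt0; exact: lt_le_trans (right_pole_ge k).
Qed.

Lemma left_pole_neq0 k : c ^+ k.+1.*2 - t != 0.
Proof. by rewrite -normr_gt0; exact: lt_le_trans (left_pole_ge k). Qed.

Let cn1 := expn_neq1 c1.

Lemma bilateral_term_le k :
  `|bilateral_term c t k| <= ((1 - r ^+ 2)^-1 + (`|t| - r ^+ 2)^-1) * r ^+ k.
Proof.
have ck : `|c ^+ k.+1| <= r ^+ k by rewrite normrX exprS ler_piMl ?exprn_ge0// ltW.
rewrite mulrDl; apply: le_trans (ler_normD _ _) _.
have inv (x y : K) : 0 < x -> x <= y -> y^-1 <= x^-1.
  by move=> x0 xy; rewrite lef_pV2// posrE (lt_le_trans x0 xy).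
apply: lerD; rewrite normrM normfV mulrC; apply: ler_pM; rewrite ?invr_ge0//.
- exact: inv (right_pole_ge k).
- exact: inv (left_pole_ge k).
Qed.

(** The product formula for the bilateral series: [finite_bilateral] in the
    limit, where the coefficients u_(N+k) u_(N-k) all tend to U^2. *)
Lemma cvg_bilateral_sum (U B rho : K) : U != 0 ->
    u @ \oo --> U -> (forall n, `|u n| <= B) ->
    (fun N => (1 - t)^-1 * \prod_(j < N) ((1 - t * c ^+ j.*2.+1) * (c ^+ j.*2.+1 - t)
       / ((1 - t * c ^+ j.+1.*2) * (c ^+ j.+1.*2 - t)))) @ \oo --> rho ->
  bilateral_sum c t @ \oo --> rho / U ^+ 2.
Proof.
move=> U0 uU uB hrho.
have B0 : 0 <= B by exact: le_trans (uB 0).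
pose f N k := u (N + k.+1)%N * u (N - k.+1)%N * bilateral_term c t k.
have shift_up k : (fun N => u (N + k.+1)%N) @ \oo --> U.
  exact: (cvg_comp (fun N => N + k.+1)%N u (cvg_addnr _) uU).
have shift_dn k : (fun N => u (N - k.+1)%N) @ \oo --> U.
  exact: (cvg_comp (fun N => N - k.+1)%N u (cvg_subnr _) uU).
have hf N k : `|f N k| <=
    B * B * ((1 - r ^+ 2)^-1 + (`|t| - r ^+ 2)^-1) * r ^+ k.
  rewrite -mulrA /f normrM normrM; apply: ler_pM; rewrite ?mulr_ge0//.
    by apply: ler_pM.
  exact: bilateral_term_le.
have hfk k : f ^~ k @ \oo --> U * U * bilateral_term c t k.
  by apply: cvgMl; apply: cvgM.
have [l hl hl'] := @tannery _ Kc f (fun k => U * U * bilateral_term c t k) _ r id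
  (normr_ge0 c) c1 hf hfk cvg_id.
have e : U ^+ 2 / (1 - t) + l = rho.
  have h : (fun N => u N ^+ 2 / (1 - t) + \sum_(k < N) f N k) @ \oo --> U ^+ 2 / (1 - t) + l.
    by apply: cvgD => //; apply: cvgMl; exact: (cvgM uU uU).
  apply: (cvg_unique (@norm_hausdorff _ _) h).
  suff -> : (fun N => u N ^+ 2 / (1 - t) + \sum_(k < N) f N k) = (fun N => (1 - t)^-1 *
      \prod_(j < N) ((1 - t * c ^+ j.*2.+1) * (c ^+ j.*2.+1 - t)
       / ((1 - t * c ^+ j.+1.*2) * (c ^+ j.+1.*2 - t)))) by [].
  by apply/funext => N; rewrite -finite_bilateral//;
    [exact: right_pole_neq0|exact: left_pole_neq0].
have -> : bilateral_sum c t = (fun N => (U ^+ 2 / (1 - t) +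
    \sum_(k < N) U * U * bilateral_term c t k) / U ^+ 2).
  apply/funext => N; rewrite /bilateral_sum -mulr_sumr -expr2 -mulrDr.
  by rewrite mulrAC divff ?mul1r// expf_neq0.
rewrite -e; apply: cvgMl; apply: cvgD => //; exact: cvg_cst.
Qed.

Local Notation X := (lattice_point c t).
Local Notation h := (fun x : K => x / (1 - x)).

Lemma lattice_point_right N k : X N (N + k)%N = t * c ^+ k.*2.
Proof. by rewrite /lattice_point doubleD shift_up. Qed.

Lemma lattice_point_left N k : (k <= N)%N -> h (X N (N - k)%N) = t / (c ^+ k.*2 - t).
Proof.
move=> kN; rewrite /lattice_point doubleB shift_downE//; last lia.
case: k kN => [|k] kN; first by rewrite expr0 divr1.
have := left_pole_neq0 k; have : c ^+ k.+1.*2 != 0 by rewrite expf_neq0.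
by move: (c ^+ _) => x x0 xt; field; rewrite x0 xt.
Qed.

Lemma lattice_bounded : exists H : K, forall N i, `|h (X N i)| <= H.
Proof.
have inv (x y : K) : 0 < x -> x <= y -> y^-1 <= x^-1.
  by move=> x0 xy; rewrite lef_pV2// posrE (lt_le_trans x0 xy).
have t10 : 1 - t != 0 by rewrite subr_eq0 eq_sym.
exists (`|1 - t|^-1 + (1 - r ^+ 2)^-1 + (`|t| - r ^+ 2)^-1) => N i.
have p1 : 0 <= `|1 - t|^-1 by rewrite invr_ge0.
have p2 : 0 <= (1 - r ^+ 2)^-1 by rewrite invr_ge0 ltW.
have p3 : 0 <= (`|t| - r ^+ 2)^-1 by rewrite invr_ge0 ltW.
have [Ni|iN] := leqP N i.
  rewrite -(subnKC Ni) lattice_point_right /=.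
  case: (i - N)%N => [|k].
    rewrite expr0 mulr1 normrM normfV -[leRHS]addrA.
    by rewrite ler_wpDr ?addr_ge0// ler_piMl.
  rewrite normrM normfV; apply: le_trans (_ : (1 - r ^+ 2)^-1 <= _).
    apply: le_trans (inv _ _ r2 (right_pole_ge k)).
    rewrite ler_piMl ?invr_ge0// normrM mulr_ile1// normrX exprn_ile1// ltW//.
  by rewrite -addrA addrCA ler_wpDr// addr_ge0.
have [k kN ->] : exists2 k, (k.+1 <= N)%N & i = (N - k.+1)%N.
  by exists (N - i).-1; move: iN; clear; lia.
rewrite lattice_point_left//.
rewrite normrM normfV; apply: le_trans (_ : (`|t| - r ^+ 2)^-1 <= _).
  apply: le_trans (inv _ _ rt (left_pole_ge k)).
  by rewrite ler_piMl ?invr_ge0.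
by rewrite ler_wpDl// addr_ge0.
Qed.

Let cX20 : (fun k => c ^+ k.*2) @ \oo --> 0.
Proof.
have -> : (fun k => c ^+ k.*2) = (fun k => (c ^+ 2) ^+ k).
  by apply/funext => k; rewrite -exprM mul2n.
apply: (cvgX0 Kc); exact: (normX_lt1 c1 1).
Qed.

Let t0 : t != 0.
Proof. by rewrite -normr_gt0 (le_lt_trans _ ct)// exprn_ge0. Qed.

(** A fixed [i] is the index i - N of the bilateral series, which tends to
    minus infinity: there X / (1 - X) tends to -1, and to 0 at the mirror point. *)
Lemma cvg_mirror_difference i :
  (fun N => h (X N i) - h (X N (N.*2 - i)%N)) @ \oo --> (-1 : K).
Proof.
pose g N := h (X N i) - h (X N (N.*2 - i)%N).
rewrite -/g -(cvg_shiftn i).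
have -> : [sequence g (N + i)%N]_N
  = (fun N => t / (c ^+ N.*2 - t) - t * c ^+ N.*2 / (1 - t * c ^+ N.*2)).
  apply/funext => N; congr (_ - _).
    by have := lattice_point_left (leq_addr i N); rewrite addKn.
  have -> : ((N + i).*2 - i = (N + i) + N)%N by lia.
  by rewrite lattice_point_right.
have e : (-1 : K) = t / (0 - t) - t * 0 / (1 - t * 0).
  by rewrite mulr0 mul0r subr0 sub0r invrN mulrN divff.
rewrite e; apply: cvgB; apply: cvgM.
- exact: cvg_cst.
- apply: cvgV; first by rewrite sub0r oppr_eq0.
  by apply: cvgB => //; exact: cvg_cst.
- by apply: cvgMr.
- apply: cvgV; first by rewrite mulr0 subr0 oner_eq0.
  by apply: cvgB; [exact: cvg_cst|apply: cvgMr].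
Qed.

(** The square of the bilateral series, a form of the addition theorem
    t Phi(t)^2 = P(t) - P(c), where P(t) is the sum over all integers n of
    X / (1 - X)^2 at X = t c^(2n).  Here [E *+ 2] is P(c), and the diagonal of the
    square gives P(t). *)
Lemma bilateral_square (Phi : K) : bilateral_sum c t @ \oo --> Phi ->
  exists2 E : K,
  (fun N => \sum_(k < N) c ^+ k.*2.+1 / (1 - c ^+ k.*2.+1) ^+ 2) @ \oo --> E &
  (fun N => t / (1 - t) ^+ 2 + \sum_(k < N) (t * c ^+ k.+1.*2 / (1 - t * c ^+ k.+1.*2) ^+ 2
       + t * c ^+ k.+1.*2 / (c ^+ k.+1.*2 - t) ^+ 2)) @ \oo --> t * Phi ^+ 2 + E *+ 2.
Proof.
move=> hPhi.
have [tau [E [C [tau_le tauE sum_tau hE]]]] := lambert_tails Kc c0 c1.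
exists E => //.
have [H hH] := lattice_bounded.
pose f N i := tau i * (h (X N i) - h (X N (N.*2 - i)%N)).
have hf N i : `|f N i| <= C * (H + H) * r ^+ i.
  rewrite normrM [leRHS]mulrAC; apply: ler_pM; [exact: normr_ge0|exact: normr_ge0|exact: tau_le|].
  by apply: le_trans (ler_normB _ _) _; apply: lerD.
have hM : (fun N => N.*2.+1) @ \oo --> \oo.
  have -> : (fun N => N.*2.+1) = (fun N => 1 + 2 * N)%N.
    by apply/funext => N; rewrite mul2n.
  apply: (cvg_comp (fun N => 2 * N)%N (fun N => 1 + N)%N); [exact: cvg_mulnl|exact: cvg_addnl].
have hfi i : f ^~ i @ \oo --> tau i * -1.
  by apply: cvgMr; exact: cvg_mirror_difference.
have [l hl hl'] := @tannery _ Kc f (fun i => tau i * -1) _ r _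
  (normr_ge0 c) c1 hf hfi hM.
have lE : l = - E.
  apply: (cvg_unique (@norm_hausdorff _ _) hl).
  have -> : (fun N => \sum_(n < N) tau n * -1) = (fun N => - \sum_(n < N) tau n).
    by apply/funext => N; rewrite -mulr_suml mulrN1.
  exact: cvgN.
pose D N := t / (1 - t) ^+ 2 + \sum_(k < N) (t * c ^+ k.+1.*2 / (1 - t * c ^+ k.+1.*2) ^+ 2
       + t * c ^+ k.+1.*2 / (c ^+ k.+1.*2 - t) ^+ 2).
have DE : D = (fun N => t * bilateral_sum c t N ^+ 2 - (\sum_(i < N.*2.+1) f N i) *+ 2).
  apply/funext => N.
  rewrite (sqr_bilateral_sum c0 cn1 right_pole_neq0 left_pole_neq0 N (tau 0)).
  rewrite -/(D N).
  under eq_bigr do rewrite tauE.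
  by rewrite addrK.
rewrite -/D DE; have -> : t * Phi ^+ 2 + E *+ 2 = t * (Phi * Phi) - (l + l).
  by rewrite lE expr2; ring.
apply: cvgB; last exact: (cvgD hl' hl').
by apply: cvgMr; exact: (cvgM hPhi hPhi).
Qed.

End Bilateral.

(** * The cubic case *)

Section Psi.
Local Open Scope classical_set_scope.
Variable K : numFieldType.
Hypothesis Kc : geometric_complete K.

Lemma cvg_odd_even_ratio (c : K) : `|c| < 1 -> exists L1 L2 B : K,
  [/\ L1 != 0, L2 != 0,
     (fun n => \prod_(i < n) (1 - c * (c ^+ 2) ^+ i)) @ \oo --> L1,
     (fun n => \prod_(i < n) (1 - c ^+ 2 * (c ^+ 2) ^+ i)) @ \oo --> L2 &
     odd_even_ratio c @ \oo --> L1 / L2 /\ forall n, `|odd_even_ratio c n| <= B].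
Proof.
move=> c1; have c21 : `|c ^+ 2| < 1 by exact: normX_lt1.
have [L1 [B1 [L10 h1 b1 _]]] := cvg_qpoch Kc c1 c21.
have [L2 [B2 [L20 h2 _ b2]]] := cvg_qpoch Kc c21 c21.
have uE : odd_even_ratio c = (fun n => (\prod_(i < n) (1 - c * (c ^+ 2) ^+ i)) *
    (\prod_(i < n) (1 - c ^+ 2 * (c ^+ 2) ^+ i))^-1).
  apply/funext => n; rewrite -prodf_div; apply: eq_bigr => i _.
  by rewrite -exprM mul2n -exprS -exprD add2n.
exists L1, L2, (B1 * B2); split=> //; rewrite uE; split.
  by apply: cvgM => //; exact: cvgV.
by move=> n; rewrite normrM; apply: ler_pM.
Qed.

End Psi.

Section CubeRoot.
Local Open Scope classical_set_scope.
Variables (F : fieldType) (w : F).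
Hypothesis w0 : 1 + w + w ^+ 2 = 0.

Lemma cube_root_neq0 : w != 0.
Proof.
by apply/eqP => h; move/eqP: w0; rewrite h expr0n !addr0 oner_eq0.
Qed.

(** Up to the constant -w, the conjugate factors 1 - w y and 1 - w^2 y multiply
    to (1 - y^3) / (1 - y): this is how the cube of the nome enters. *)
Lemma mul_cube_root_factors (y : F) :
  (1 - w * y) * (y - w) = - w * (1 + y + y ^+ 2).
Proof.
transitivity (- w * (1 + y + y ^+ 2) + y * (1 + w + w ^+ 2)); first by ring.
by rewrite w0 mulr0 addr0.
Qed.

Lemma sqr_1B_cube_root : (1 - w) ^+ 2 = - 3%:R * w.
Proof.
transitivity (- 3%:R * w + (1 + w + w ^+ 2)); first by ring.
by rewrite w0 addr0.
Qed.

Lemma bilateral_term_cube_root (x : F) k :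
    1 - x ^+ k.+1.*2 != 0 -> 1 - x ^+ k.+1.*2 ^+ 3 != 0 ->
    1 - w * x ^+ k.+1.*2 != 0 -> x ^+ k.+1.*2 - w != 0 ->
  (1 - w) * bilateral_term x w k
  = 3%:R * ((x ^+ k.+1 - x ^+ k.+1 ^+ 5) / (1 - x ^+ k.+1 ^+ 6)).
Proof.
rewrite /bilateral_term -muln2 exprM; move: (x ^+ k.+1) => z e1 e3 d1 d2.
have e6 : (1 - z ^+ 6) = (1 - z ^+ 2) * (1 + z ^+ 2 + (z ^+ 2) ^+ 2) by ring.
have s0 : 1 + z ^+ 2 + (z ^+ 2) ^+ 2 != 0.
  by move: e3; apply: contraNneq => h; rewrite -exprM e6 h mulr0.
have wn0 := cube_root_neq0.
transitivity ((1 - w) ^+ 2 * (z * (1 + z ^+ 2)) / ((1 - w * z ^+ 2) * (z ^+ 2 - w))).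
  by field; rewrite d1 d2.
rewrite mul_cube_root_factors sqr_1B_cube_root e6.
by field; rewrite oppr_eq0 wn0 s0 e1.
Qed.

Lemma square_term_cube_root (y : F) :
    1 - y != 0 -> 1 - y ^+ 3 != 0 -> 1 - w * y != 0 -> y - w != 0 ->
  w * y / (1 - w * y) ^+ 2 + w * y / (y - w) ^+ 2
  = 9%:R * y ^+ 3 / (1 - y ^+ 3) ^+ 2 - y / (1 - y) ^+ 2.
Proof.
move=> e1 e3 d1 d2.
have eE : 1 - y ^+ 3 = (1 - y) * (1 + y + y ^+ 2) by ring.
have s0 : 1 + y + y ^+ 2 != 0.
  by move: e3; apply: contraNneq => h; rewrite eE h mulr0.
have wn0 := cube_root_neq0.
transitivity (w * y * ((y - w) ^+ 2 + (1 - w * y) ^+ 2) / ((1 - w * y) * (y - w)) ^+ 2).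
  by field; rewrite d1 d2.
have -> : (y - w) ^+ 2 + (1 - w * y) ^+ 2 = - w * (1 + 4%:R * y + y ^+ 2).
  transitivity (- w * (1 + 4%:R * y + y ^+ 2) + (1 + y ^+ 2) * (1 + w + w ^+ 2)); first by ring.
  by rewrite w0 mulr0 addr0.
rewrite mul_cube_root_factors eE.
by field; rewrite ?oppr_eq0 wn0 s0 e1.
Qed.

End CubeRoot.

Section PartA.
Local Open Scope classical_set_scope.
Variable K : numFieldType.
Hypothesis Kc : geometric_complete K.
Variables (x w : K).
Hypothesis x0 : x != 0.
Hypothesis x1 : `|x| < 1.
Hypothesis w0 : 1 + w + w ^+ 2 = 0.
Local Notation r := (`|x|).

Lemma norm_cube_root : `|w| = 1.
Proof.
have w3 : w ^+ 3 = 1.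
  apply/eqP; rewrite -subr_eq0.
  have -> : w ^+ 3 - 1 = (w - 1) * (1 + w + w ^+ 2) by ring.
  by rewrite w0 mulr0.
by apply/eqP; rewrite -(@pexpr_eq1 _ _ 3)// -normrX w3 normr1.
Qed.

Lemma cube_root_neq1 : w != 1.
Proof.
apply/eqP => h; move/eqP: w0; rewrite h expr1n.
have -> : 1 + 1 + 1 = 3%:R :> K by ring.
by rewrite pnatr_eq0.
Qed.

Let ct : r ^+ 2 < `|w|. Proof. by rewrite norm_cube_root exprn_ilt1. Qed.
Let w_le1 : `|w| <= 1. Proof. by rewrite norm_cube_root. Qed.
Let oneBX k : 1 - x ^+ k.+1 != 0.
Proof. by rewrite subr_eq0 eq_sym expn_neq1. Qed.
Let p1 := right_pole_neq0 x1 w_le1 cube_root_neq1.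
Let p2 := left_pole_neq0 x1 ct.

Lemma prod_cube_root N :
  \prod_(j < N) ((1 - w * x ^+ j.*2.+1) * (x ^+ j.*2.+1 - w)
       / ((1 - w * x ^+ j.+1.*2) * (x ^+ j.+1.*2 - w)))
  = odd_even_ratio (x ^+ 3) N / odd_even_ratio x N.
Proof.
rewrite -prodf_div; apply: eq_bigr => j _.
rewrite !(mul_cube_root_factors w0) doubleS.
rewrite -(exprM x 3) (mulnC 3) (exprM x j.*2.+1).
rewrite -(exprM x 3) (mulnC 3) (exprM x j.*2.+2).
have e1 := oneBX j.*2; have e2 := oneBX j.*2.+1.
have e3 : 1 - x ^+ j.*2.+1 ^+ 3 != 0 by rewrite -exprM; exact: oneBX.
have e4 : 1 - x ^+ j.*2.+2 ^+ 3 != 0 by rewrite -exprM; exact: oneBX.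
have wn0 := cube_root_neq0 w0.
move: (x ^+ j.*2.+1) (x ^+ j.*2.+2) e1 e2 e3 e4 => y z e1 e2.
have e (v : K) : 1 - v ^+ 3 = (1 - v) * (1 + v + v ^+ 2) by ring.
rewrite !e !mulf_eq0 !negb_or => /andP[_ e3] /andP[_ e4].
by field; rewrite e2 e1 e4 wn0.
Qed.

Section WithPsi.
Local Open Scope classical_set_scope.
Variables (U U3 : K).
Hypothesis U0 : U != 0.
Hypothesis uU : odd_even_ratio x @ \oo --> U.
Hypothesis uU3 : odd_even_ratio (x ^+ 3) @ \oo --> U3.
Local Notation f := (U3 / U ^+ 3).

(** At t = w the product formula is the quotient psi^3(x) / psi(x^3), up to the
    factor 1 - w. *)
Lemma cubic_bilateral : bilateral_sum x w @ \oo --> f / (1 - w).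
Proof.
have [L1 [L2 [B [_ _ _ _ [_ hB]]]]] := cvg_odd_even_ratio Kc x1.
have h : (fun N => (1 - w)^-1 * \prod_(j < N) ((1 - w * x ^+ j.*2.+1) * (x ^+ j.*2.+1 - w)
       / ((1 - w * x ^+ j.+1.*2) * (x ^+ j.+1.*2 - w)))) @ \oo --> (1 - w)^-1 * (U3 / U).
  have -> : (fun N => (1 - w)^-1 * \prod_(j < N) ((1 - w * x ^+ j.*2.+1) * (x ^+ j.*2.+1 - w)
       / ((1 - w * x ^+ j.+1.*2) * (x ^+ j.+1.*2 - w)))) =
     (fun N => (1 - w)^-1 * (odd_even_ratio (x ^+ 3) N * (odd_even_ratio x N)^-1)).
    by apply/funext => N; rewrite prod_cube_root.
  by apply: cvgMr; apply: cvgM => //; exact: cvgV.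
have := cvg_bilateral_sum Kc x0 x1 ct w_le1 cube_root_neq1 U0 uU hB h.
have w10 : 1 - w != 0 by rewrite subr_eq0 eq_sym cube_root_neq1.
suff -> : (1 - w)^-1 * (U3 / U) / U ^+ 2 = f / (1 - w) by [].
by field; rewrite w10 U0.
Qed.

(** Pairing the indices n and -n of the bilateral series gives
    \sum_n (x^n - x^(5n)) / (1 - x^(6n)); expanding the denominator and exchanging
    the sums gives the Lambert series. *)
Lemma cubic_lambert_series :
  (fun N => \sum_(k < N) (x ^+ (6 * k + 1) / (1 - x ^+ (6 * k + 1))
      - x ^+ (6 * k + 5) / (1 - x ^+ (6 * k + 5)))) @ \oo --> (f - 1) / 3%:R.
Proof.
have w10 : 1 - w != 0 by rewrite subr_eq0 eq_sym cube_root_neq1.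
pose b n := (x ^+ n.+1 - x ^+ n.+1 ^+ 5) / (1 - x ^+ n.+1 ^+ 6).
have hb : (fun N => \sum_(n < N) b n) @ \oo --> (f - 1) / 3%:R.
  have -> : (fun N => \sum_(n < N) b n) =
     (fun N => ((1 - w) * bilateral_sum x w N - 1) / 3%:R).
    apply/funext => N; rewrite /bilateral_sum mulrDr divff// addrC addrA addNr add0r.
    rewrite mulr_sumr mulr_suml; apply: eq_bigr => k _.
    rewrite (bilateral_term_cube_root w0) ?p1 ?p2//.
    - by rewrite [RHS]mulrAC divff ?mul1r// pnatr_eq0.
    - exact: oneBX.
    - by rewrite -exprM; exact: oneBX.
  apply: cvgMl; apply: cvgB; last exact: cvg_cst.
  have -> : f = (1 - w) * (f / (1 - w)) by rewrite [RHS]mulrC divfK.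
  by apply: cvgMr; exact: cubic_bilateral.
pose a n k := x ^+ n.+1 ^+ (6 * k + 1) - x ^+ n.+1 ^+ (6 * k + 5).
have ha n k : `|a n k| <= (1 + 1) * r ^+ n * r ^+ k.
  have le m : (n + k <= m)%N -> `|x ^+ m| <= r ^+ n * r ^+ k.
    by move=> nk; rewrite normrX -exprD; apply: ler_wiXn2l => //; exact: ltW.
  rewrite -mulrA mulrDl mul1r; apply: le_trans (ler_normB _ _) _.
  by apply: lerD; rewrite -exprM; apply: le; nia.
have rows n : (fun N => \sum_(k < N) a n k) @ \oo --> b n.
  have -> : (fun N => \sum_(k < N) a n k) =
     (fun N => (x ^+ n.+1 - x ^+ n.+1 ^+ 5) * \sum_(k < N) (x ^+ n.+1 ^+ 6) ^+ k).
    apply/funext => N; rewrite mulr_sumr; apply: eq_bigr => k _; rewrite /a.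
    by rewrite (exprD _ (6 * k) 1) (exprD _ (6 * k) 5) (exprM _ 6 k); ring.
  apply: cvgMr; apply: (geometric_series Kc).
  by rewrite -exprM normrX exprn_ilt1.
have cols k : (fun N => \sum_(n < N) a n k) @ \oo --> x ^+ (6 * k + 1) / (1 - x ^+ (6 * k + 1))
      - x ^+ (6 * k + 5) / (1 - x ^+ (6 * k + 5)).
  have -> : (fun N => \sum_(n < N) a n k) =
     (fun N => x ^+ (6 * k + 1) * (\sum_(n < N) (x ^+ (6 * k + 1)) ^+ n) -
       x ^+ (6 * k + 5) * \sum_(n < N) (x ^+ (6 * k + 5)) ^+ n).
    apply/funext => N; rewrite !mulr_sumr -sumrB; apply: eq_bigr => n _.
    by rewrite /a -!exprS -!exprM !(mulnC n.+1).
  by apply: cvgB; apply: cvgMr; apply: (geometric_series Kc);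
    rewrite normrX exprn_ilt1// addn_eq0 andbF.
have [l hl hl'] := exchange_series Kc (normr_ge0 x) x1 ha rows cols.
suff -> : (f - 1) / 3%:R = l by [].
exact: (cvg_unique (@norm_hausdorff _ _) hb hl).
Qed.

(** [bilateral_square] at t = w, multiplied by (1 - w)^2 / w = -3. *)
Lemma cubic_square_series :
  (fun N => \sum_(k < N) (x ^+ k.+1.*2 / (1 - x ^+ k.+1.*2) ^+ 2
      + 2%:R * x ^+ k.*2.+1 / (1 - x ^+ k.*2.+1) ^+ 2
      - 9%:R * x ^+ k.+1.*2 ^+ 3 / (1 - x ^+ k.+1.*2 ^+ 3) ^+ 2)) @ \oo --> (f ^+ 2 - 1) / 3%:R.
Proof.
have wn0 := cube_root_neq0 w0.
have [E hE hD] := bilateral_square Kc x0 x1 ct w_le1 cube_root_neq1 cubic_bilateral.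
have -> : (f ^+ 2 - 1) / 3%:R
    = (E + E) - (w * (f / (1 - w)) ^+ 2 + E *+ 2 - w / (1 - w) ^+ 2).
  rewrite !expr_div_n !(sqr_1B_cube_root w0).
  by field; rewrite wn0 U0.
have -> : (fun N => \sum_(k < N) (x ^+ k.+1.*2 / (1 - x ^+ k.+1.*2) ^+ 2
      + 2%:R * x ^+ k.*2.+1 / (1 - x ^+ k.*2.+1) ^+ 2
      - 9%:R * x ^+ k.+1.*2 ^+ 3 / (1 - x ^+ k.+1.*2 ^+ 3) ^+ 2)) =
  (fun N => (\sum_(k < N) x ^+ k.*2.+1 / (1 - x ^+ k.*2.+1) ^+ 2 +
     \sum_(k < N) x ^+ k.*2.+1 / (1 - x ^+ k.*2.+1) ^+ 2) -
    (w / (1 - w) ^+ 2 + \sum_(k < N) (w * x ^+ k.+1.*2 / (1 - w * x ^+ k.+1.*2) ^+ 2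
       + w * x ^+ k.+1.*2 / (x ^+ k.+1.*2 - w) ^+ 2) - w / (1 - w) ^+ 2)).
  apply/funext => N; rewrite [X in _ - X]addrC addKr -big_split -sumrB.
  apply: eq_bigr => k _ /=.
  rewrite (square_term_cube_root w0) ?p1 ?p2//.
  - by ring.
  - exact: oneBX.
  - by rewrite -exprM; exact: oneBX.
apply: cvgB; first exact: cvgD.
by apply: cvgB => //; exact: cvg_cst.
Qed.

End WithPsi.
End PartA.

(** * The quarter-period case *)

Section PartB.
Local Open Scope classical_set_scope.
Variable K : numFieldType.
Hypothesis Kc : geometric_complete K.
Variable q : K.
Hypothesis q0 : q != 0.
Hypothesis q1 : `|q| < 1.
Local Notation r := (`|q|).
Local Notation z k := (q ^+ k.*2.+1).

Let oneBX k : 1 - q ^+ k.+1 != 0.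
Proof. by rewrite subr_eq0 eq_sym expn_neq1. Qed.
Let qn k : q ^+ k != 0. Proof. by rewrite expf_neq0. Qed.

(* With c = q^2 the period of the lattice is c^2 = q^4, and t = q is a quarter
   of it. *)
Let c := q ^+ 2.
Let c0 : c != 0. Proof. exact: qn. Qed.
Let c1 : `|c| < 1. Proof. exact: normX_lt1. Qed.
Let q_le1 : r <= 1. Proof. exact: ltW. Qed.
Let q_neq1 : q != 1. Proof. by rewrite -subr_eq0 -oppr_eq0 opprB -(expr1 q) oneBX. Qed.
Let ct : `|c| ^+ 2 < r.
Proof.
rewrite -normrX -exprM normrX -[ltRHS]expr1.
by rewrite ltr_iXn2l// normr_gt0.
Qed.

(** At the quarter period the theta quotient telescopes, and the product formula
    reduces to its constant factor psi^2(q^2). *)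
Lemma prod_quarter_period N :
  (1 - q)^-1 * \prod_(j < N) ((1 - q * c ^+ j.*2.+1) * (c ^+ j.*2.+1 - q)
       / ((1 - q * c ^+ j.+1.*2) * (c ^+ j.+1.*2 - q)))
  = (1 - q ^+ (4 * N).+1)^-1.
Proof.
elim: N => [|N IH]; first by rewrite big_ord0 mulr1 expr1.
rewrite big_ord_recr /= [LHS]mulrA IH doubleS /c -!exprM.
have -> : (4 * N.+1 = 4 * N + 4)%N by clear; lia.
have -> : (2 * N.*2.+2 = (4 * N).+4)%N by clear; lia.
have -> : (2 * N.*2.+1 = (4 * N).+2)%N by clear; lia.
have := oneBX (4 * N).+4; have := oneBX (4 * N).+2; have := oneBX (4 * N).
rewrite addn4 !(exprS q (_ + _)) !exprS; move: (q ^+ (4 * N)) => y e1 e3 e5.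
have d1 : q * (q * y) - q != 0.
  have -> : q * (q * y) - q = - q * (1 - q * y) by ring.
  by rewrite mulf_neq0// oppr_eq0.
have d3 : q * (q * (q * (q * y))) - q != 0.
  have -> : q * (q * (q * (q * y))) - q = - q * (1 - q * (q * (q * y))) by ring.
  by rewrite mulf_neq0// oppr_eq0.
by field; rewrite e1 e5 d3.
Qed.

Section WithPsi.
Local Open Scope classical_set_scope.
Variable U : K.
Hypothesis U0 : U != 0.
Hypothesis uU : odd_even_ratio c @ \oo --> U.

Lemma cvg_quarter_period : bilateral_sum c q @ \oo --> (U ^+ 2)^-1.
Proof.
have [L1 [L2 [B [_ _ _ _ [_ hB]]]]] := cvg_odd_even_ratio Kc c1.
have h : (fun N => (1 - q)^-1 * \prod_(j < N) ((1 - q * c ^+ j.*2.+1) * (c ^+ j.*2.+1 - q)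
       / ((1 - q * c ^+ j.+1.*2) * (c ^+ j.+1.*2 - q)))) @ \oo --> (1 : K).
  have -> : (fun N => (1 - q)^-1 * \prod_(j < N) ((1 - q * c ^+ j.*2.+1) * (c ^+ j.*2.+1 - q)
       / ((1 - q * c ^+ j.+1.*2) * (c ^+ j.+1.*2 - q)))) =
     (fun N => (1 - q * (q ^+ 4) ^+ N)^-1).
    by apply/funext => N; rewrite prod_quarter_period exprS exprM.
  have e : (1 : K) = (1 - q * 0)^-1 by rewrite mulr0 subr0 invr1.
  rewrite {2}e; apply: cvgV; first by rewrite mulr0 subr0 oner_eq0.
  apply: cvgB; first exact: cvg_cst.
  by apply: cvgMr; apply: (cvgX0 Kc); exact: (normX_lt1 q1 3).
have := cvg_bilateral_sum Kc c0 c1 ct q_le1 q_neq1 U0 uU hB h.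
by rewrite div1r.
Qed.

Local Notation g y := (y / (1 - y) ^+ 2).
Local Notation S y := (y * (1 + y ^+ 2) / (1 - y ^+ 2) ^+ 2).

(** Since y / (1 - y)^2 is invariant under y -> 1/y, the points q^(4n+1), n in
    Z, cover each odd power of q once. *)
Lemma diag_quarter_period N :
  q / (1 - q) ^+ 2 + \sum_(k < N) (q * c ^+ k.+1.*2 / (1 - q * c ^+ k.+1.*2) ^+ 2
       + q * c ^+ k.+1.*2 / (c ^+ k.+1.*2 - q) ^+ 2)
  = \sum_(k < N.*2.+1) g (z k).
Proof.
elim: N => [|N IH]; first by rewrite big_ord0 big_ord1 addr0 expr1.
rewrite big_ord_recr /= addrA IH doubleS [RHS]big_ord_recr /= [in RHS]big_ord_recr /= -addrA.
congr (_ + _); rewrite [RHS]addrC /c -!exprM.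
have -> : (2 * N.*2.+2 = (4 * N).+4)%N by clear; lia.
have -> : (N.*2.+2.*2.+1 = (4 * N).+4.+1)%N by clear; lia.
have -> : (N.*2.+1.*2.+1 = (4 * N).+3)%N by clear; lia.
rewrite -exprS; congr (_ + _).
have := oneBX (4 * N).+2; rewrite ![q ^+ _.+1]exprS; move: (q ^+ (4 * N)) => y e3.
have d3 : q * (q * (q * (q * y))) - q != 0.
  have -> : q * (q * (q * (q * y))) - q = - q * (1 - q * (q * (q * y))) by ring.
  by rewrite mulf_neq0// oppr_eq0.
by field; rewrite e3 d3.
Qed.

(** [bilateral_square] at the quarter period, with
    y / (1 - y)^2 - 2 y^2 / (1 - y^2)^2 = y (1 + y^2) / (1 - y^2)^2. *)
Lemma cvg_odd_square_sum : (fun N => \sum_(k < N) S (z k)) @ \oo --> q / U ^+ 4.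
Proof.
have [E hE hD] := bilateral_square Kc c0 c1 ct q_le1 q_neq1 cvg_quarter_period.
have d0 : 0 < 1 - r by rewrite subr_gt0.
have [n|G hG] := @Kc (fun k => g (z k)) (((1 - r) ^+ 2)^-1) r (normr_ge0 q) q1.
  rewrite normrM normfV mulrC normrX; apply: ler_pM; rewrite ?invr_ge0 ?exprn_ge0//.
    have h := norm_1BX_ge q1 n.*2.
    rewrite lef_pV2 ?posrE ?exprn_gt0//; last exact: lt_le_trans h.
    by rewrite ler_pXn2r// nnegrE// ltW.
  by rewrite normrX; apply: ler_wiXn2l => //; clear; lia.
(* The diagonal converges along odd lengths; the full series converges, so it
   has the same limit. *)
have hM : (fun N => N.*2.+1) @ \oo --> \oo.
  have -> : (fun N => N.*2.+1) = (fun N => 1 + 2 * N)%N.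
    by apply/funext => N; rewrite mul2n.
  apply: (cvg_comp (fun N => 2 * N)%N (fun N => 1 + N)%N); [exact: cvg_mulnl|exact: cvg_addnl].
have GE : G = q * (U ^+ 2)^-1 ^+ 2 + E *+ 2.
  apply: (cvg_unique (@norm_hausdorff _ _) _ hD).
  have -> : (fun N => q / (1 - q) ^+ 2 + \sum_(k < N) (q * c ^+ k.+1.*2 / (1 - q * c ^+ k.+1.*2) ^+ 2
       + q * c ^+ k.+1.*2 / (c ^+ k.+1.*2 - q) ^+ 2)) = (fun N => \sum_(k < N.*2.+1) g (z k)).
    by apply/funext => N; rewrite diag_quarter_period.
  exact: (cvg_comp (fun N => N.*2.+1) (fun N => \sum_(k < N) g (z k)) hM hG).
have -> : q / U ^+ 4 = G - (E + E) by rewrite GE; field.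
have -> : (fun N => \sum_(k < N) S (z k)) = (fun N => \sum_(k < N) g (z k) -
   (\sum_(k < N) c ^+ k.*2.+1 / (1 - c ^+ k.*2.+1) ^+ 2 +
    \sum_(k < N) c ^+ k.*2.+1 / (1 - c ^+ k.*2.+1) ^+ 2)).
  apply/funext => N; rewrite -big_split -sumrB; apply: eq_bigr => k _ /=.
  rewrite /c (exprAC _ 2); have e1 := oneBX k.*2.
  have : 1 - z k ^+ 2 != 0 by rewrite -exprM muln2; exact: oneBX.
  move: (z k) e1 => y e1.
  have -> : 1 - y ^+ 2 = (1 - y) * (1 + y) by ring.
  rewrite mulf_eq0 negb_or => /andP[_ e2].
  by field; rewrite e1 e2.
by apply: cvgB => //; exact: cvgD.
Qed.

End WithPsi.

(** Each of the [n] terms r^0, ..., r^(n-1) is at least r^n. *)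
Lemma mulrn_geometric_le n : n%:R * r ^+ n <= (1 - r)^-1.
Proof.
have h := geometric_sum_le 0 n (normr_ge0 q) q1.
rewrite expr0 mul1r in h; apply: le_trans h; rewrite big_mkord mulr_natl.
rewrite -[X in _ *+ X](card_ord n) -sumr_const; apply: ler_sum => i _.
by apply: ler_wiXn2l; [exact: normr_ge0|exact: ltW|exact: ltnW].
Qed.

(** The sum S of (2n+1) y^(2n+1) satisfies
    S - y^2 S = y + 2 y^3 + 2 y^5 + ..., a geometric series. *)
Lemma sum_odd_multiples_eq (y : K) (L : K) : `|y| < 1 ->
  (fun N => \sum_(n < N) n.*2.+1%:R * y ^+ n.*2.+1) @ \oo --> L ->
  L = y * (1 + y ^+ 2) / (1 - y ^+ 2) ^+ 2.
Proof.
move=> y1 hL.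
have y21 : `|y ^+ 2| < 1 by exact: (normX_lt1 y1 1).
have yy : 1 - y ^+ 2 != 0.
  by rewrite subr_eq0 eq_sym; exact: (expn_neq1 y1 1).
pose s N := \sum_(n < N) n.*2.+1%:R * y ^+ n.*2.+1.
have rec N : s N.+1 - y ^+ 2 * s N = y + 2%:R * y ^+ 3 * \sum_(n < N) (y ^+ 2) ^+ n.
  elim: N => [|N IH]; first by rewrite /s big_ord1 !big_ord0 !mulr0 mul1r subr0 addr0.
  rewrite [s N.+2]/s big_ord_recr /= -/(s N.+1) [s N.+1 in X in _ - X]/s big_ord_recr /= -/(s N).
  rewrite [X in _ = _ + _ * X]big_ord_recr /= (mulrDr (2%:R * _)) addrA -IH.
  rewrite doubleS -exprM mul2n -![_.+3%:R]natr1 -!natr1 !exprS; ring.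
have h : (fun N => s N.+1 - y ^+ 2 * s N) @ \oo --> L - y ^+ 2 * L.
  apply: cvgB; last by apply: cvgMr.
  by move: hL; rewrite -(cvg_shiftS s).
have h' : (fun N => s N.+1 - y ^+ 2 * s N) @ \oo --> y + 2%:R * y ^+ 3 * (1 - y ^+ 2)^-1.
  have -> : (fun N => s N.+1 - y ^+ 2 * s N) =
     (fun N => y + 2%:R * y ^+ 3 * \sum_(n < N) (y ^+ 2) ^+ n) by exact/funext.
  apply: cvgD; first exact: cvg_cst.
  by apply: cvgMr; apply: (geometric_series Kc).
have e := cvg_unique (@norm_hausdorff _ _) h h'.
apply: (mulfI yy); rewrite mulrBl mul1r e.
by field.
Qed.

Lemma odd_lambert_series (G : K) :
  (fun N => \sum_(k < N) z k * (1 + z k ^+ 2) / (1 - z k ^+ 2) ^+ 2) @ \oo --> G ->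
  (fun N => \sum_(n < N) n.*2.+1%:R * z n / (1 - z n ^+ 2)) @ \oo --> G.
Proof.
move=> hG; have d0 : 0 < 1 - r by rewrite subr_gt0.
pose a n k := n.*2.+1%:R * z n ^+ k.*2.+1.
pose C := 2%:R * (1 - r)^-1 + 1.
have C0 : 0 <= C by rewrite addr_ge0// mulr_ge0// invr_ge0 ltW.
have ha n k : `|a n k| <= C * r ^+ n * r ^+ k.
  have hn : n.*2.+1%:R * r ^+ n <= C.
    rewrite -natr1 -mul2n natrM mulrDl mul1r -mulrA; apply: lerD.
      by apply: ler_wpM2l => //; exact: mulrn_geometric_le.
    by rewrite exprn_ile1// ltW.
  rewrite /a normrM -exprM normrX normr_nat.
  apply: (@le_trans _ _ (n.*2.+1%:R * r ^+ n * r ^+ n * r ^+ k)).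
    rewrite -!mulrA -!exprD; apply: ler_wpM2l => //.
    by apply: ler_wiXn2l; [exact: normr_ge0|exact: ltW|clear; nia].
  by apply: ler_wpM2r; [exact: exprn_ge0|apply: ler_wpM2r; [exact: exprn_ge0|]].
have rows n : (fun N => \sum_(k < N) a n k) @ \oo --> n.*2.+1%:R * z n / (1 - z n ^+ 2).
  have -> : (fun N => \sum_(k < N) a n k) =
    (fun N => n.*2.+1%:R * z n * \sum_(k < N) (z n ^+ 2) ^+ k).
    apply/funext => N; rewrite mulr_sumr; apply: eq_bigr => k _.
    by rewrite /a (exprS (z n) k.*2) -(mul2n k) (exprM (z n) 2); ring.
  apply: cvgMr; apply: (geometric_series Kc).
  by rewrite -exprM normrX exprn_ilt1.
have ha' k n : `|a n k| <= C * r ^+ k * r ^+ n by rewrite mulrAC.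
have cols k : (fun N => \sum_(n < N) a n k) @ \oo --> z k * (1 + z k ^+ 2) / (1 - z k ^+ 2) ^+ 2.
  have [L hL] := @Kc (fun n => a n k) _ _ (normr_ge0 q) q1 (ha' k).
  have aE : (fun N => \sum_(n < N) a n k) = (fun N => \sum_(n < N) n.*2.+1%:R * z k ^+ n.*2.+1).
    by apply/funext => N; apply: eq_bigr => n _; rewrite /a exprAC.
  by rewrite -(sum_odd_multiples_eq (normX_lt1 q1 _) (L := L)) -?aE.
have [l hl hl'] := exchange_series Kc (normr_ge0 q) q1 ha rows cols.
by rewrite (cvg_unique (@norm_hausdorff _ _) hG hl').
Qed.

End PartB.

(** * The square of the sum over odd powers *)

Section Square.
Local Open Scope classical_set_scope.
Variable K : numFieldType.
Hypothesis Kc : geometric_complete K.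
Variable q : K.
Hypothesis q0 : q != 0.
Hypothesis q1 : `|q| < 1.
Local Notation r := (`|q|).
Local Notation z k := (q ^+ k.*2.+1).
Local Notation c := (q ^+ 2).
(* With D = y d/dy, [v1] is D v, [v2] is D^2 v, [H (y^2)] is D^2 / 4 applied to
   y^2 / (1 - y^2), and [T (y^2)] is D^2 / 4 applied to v^2. *)
Local Notation v y := (y / (1 - y ^+ 2)).
Local Notation v1 y := (y * (1 + y ^+ 2) / (1 - y ^+ 2) ^+ 2).
Local Notation v2 y := (y * (1 + 6%:R * y ^+ 2 + y ^+ 4) / (1 - y ^+ 2) ^+ 3).
Local Notation H x := (x * (1 + x) / (1 - x) ^+ 3).
Local Notation T x := (x * (1 + 4%:R * x + x ^+ 2) / (1 - x) ^+ 4).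

Let oneBX k : 1 - q ^+ k.+1 != 0.
Proof. by rewrite subr_eq0 eq_sym expn_neq1. Qed.
Let qn k : q ^+ k != 0. Proof. by rewrite expf_neq0. Qed.
Let oneBz2 k : 1 - z k ^+ 2 != 0.
Proof. by rewrite -exprM muln2; exact: oneBX. Qed.

(** The odd power q^(2n+1) with n = i - N: the range [i < N.*2] is symmetric
    under inversion. *)
Definition odd_power N i := z i / q ^+ N.*2.
Local Notation Y := odd_power.

Lemma odd_power_right N k : Y N (N + k) = z k.
Proof.
rewrite /Y doubleD -addnS exprD mulrC mulKf//.
Qed.

Lemma odd_power_left N k : (k < N)%N -> Y N (N - k.+1) = (z k)^-1.
Proof.
move=> kN; rewrite /Y.
have -> : q ^+ N.*2 = q ^+ (N - k.+1).*2.+1 * z k.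
  by rewrite -exprD; congr (_ ^+ _); move: kN; clear; lia.
by rewrite invfM mulrA divff// mul1r.
Qed.

Lemma odd_powerP N i : exists k, Y N i = z k \/ Y N i = (z k)^-1.
Proof.
have [Ni|iN] := leqP N i.
  by exists (i - N)%N; left; rewrite -(odd_power_right N) subnKC.
exists (N - i).-1; right; rewrite -(@odd_power_left N).
  by congr (Y N _); move: iN; clear; lia.
by move: iN; clear; lia.
Qed.

Lemma oneB_sqr_Y_neq0 N i : 1 - Y N i ^+ 2 != 0.
Proof.
have [k [->|->]] := odd_powerP N i; first exact: oneBz2.
have := oneBz2 k; have := qn k.*2.+1; move: (z k) => y y0; apply: contraNneq => h.
have -> : 1 - y ^+ 2 = - y ^+ 2 * (1 - y^-1 ^+ 2) by field.
by rewrite h mulr0.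
Qed.

Lemma H_inv (y : K) : y != 0 -> 1 - y ^+ 2 != 0 -> H (y^-1 ^+ 2) = - H (y ^+ 2).
Proof.
move=> y0 y2; have y2' : y ^+ 2 - 1 != 0 by rewrite -opprB oppr_eq0.
by field; rewrite ?y0 ?y2 ?y2'.
Qed.

(** Apply D^2 to the splitting of v(y) v(y') used for the square of the
    bilateral series: it turns v v' into v2 v' + 2 v1 v1' + v v2'.  Because v is odd
    under y -> 1/y, it sums to zero over the symmetric range, so that summing over
    all pairs leaves only the square of the sum of v1. *)
Lemma sqr_odd_sum N (w : K) :
  (\sum_(k < N) v1 (z k)) ^+ 2 = \sum_(k < N) T (z k ^+ 2)
    + \sum_(i < N.*2) (w - \sum_(d < i) c ^+ d.+1 / (1 - c ^+ d.+1.*2))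
        * (H (Y N i ^+ 2) - H (Y N (N.*2.-1 - i) ^+ 2)).
Proof.
pose s i j := v2 (Y N i) * v (Y N j) + 2%:R * (v1 (Y N i) * v1 (Y N j)) + v (Y N i) * v2 (Y N j).
have sC i j : s i j = s j i by rewrite /s; ring.
have eight0 : (8%:R : K) != 0 by rewrite pnatr_eq0.
have sv : \sum_(i < N.*2) v (Y N i) = 0.
  rewrite (big_centered_even _ (fun i => v (Y N i))) big1// => k _ /=.
  rewrite odd_power_right odd_power_left//.
  have := oneBz2 k; have := qn k.*2.+1; move: (z k) => y y0 y2.
  have y2' : y ^+ 2 - 1 != 0 by rewrite -opprB oppr_eq0.
  by field; rewrite ?y0 ?y2 ?y2'.
have sv1 : \sum_(i < N.*2) v1 (Y N i) = (\sum_(k < N) v1 (z k)) *+ 2.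
  rewrite (big_centered_even _ (fun i => v1 (Y N i))) -sumrMnl; apply: eq_bigr => k _ /=.
  rewrite odd_power_right odd_power_left//.
  have := oneBz2 k; have := qn k.*2.+1; move: (z k) => y y0 y2.
  have y2' : y ^+ 2 - 1 != 0 by rewrite -opprB oppr_eq0.
  by field; rewrite ?y0 ?y2 ?y2'.
have sd : \sum_(i < N.*2) s i i = 8%:R * \sum_(k < N) T (z k ^+ 2).
  rewrite (big_centered_even _ (fun i => s i i)) mulr_sumr; apply: eq_bigr => k _ /=.
  rewrite /s odd_power_right odd_power_left//.
  have := oneBz2 k; have := qn k.*2.+1; move: (z k) => y y0 y2.
  have y2' : y ^+ 2 - 1 != 0 by rewrite -opprB oppr_eq0.
  by field; rewrite ?y0 ?y2 ?y2'.
have so : \sum_(j < N.*2) \sum_(i < j) s i j = 4%:R *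
    \sum_(i < N.*2) (w - \sum_(d < i) c ^+ d.+1 / (1 - c ^+ d.+1.*2))
        * (H (Y N i ^+ 2) - H (Y N (N.*2.-1 - i) ^+ 2)).
  rewrite -(sum_off_diagonal (fun d => c ^+ d / (1 - c ^+ d.*2)) (fun i => H (Y N i ^+ 2))).
  rewrite mulr_sumr; apply: eq_bigr => j _; rewrite mulr_sumr; apply: eq_bigr => i _.
  have ij : (i < j)%N := ltn_ord i.
  have Yj : Y N j = Y N i * c ^+ (j - i).
    rewrite /Y mulrAC -exprM -exprD; congr (_ ^+ _ / _).
    by move: ij; clear; lia.
  have d1 : 1 - (c ^+ (j - i)) ^+ 2 != 0.
    by rewrite -!exprM -(prednK (_ : 0 < 2 * ((j - i) * 2))%N) ?oneBX//; move: ij; clear; lia.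
  have := oneB_sqr_Y_neq0 N i; have := oneB_sqr_Y_neq0 N j; rewrite /s Yj.
  rewrite -(muln2 (j - i)) (exprM c).
  move: (c ^+ (j - i)) (Y N i) d1 => d y d1 e2 e1.
  by field; rewrite d1 e1 e2.
have e : 8%:R * (\sum_(k < N) v1 (z k)) ^+ 2 = \sum_(i < N.*2) \sum_(j < N.*2) s i j.
  transitivity ((\sum_(i < N.*2) v2 (Y N i)) * (\sum_(j < N.*2) v (Y N j))
     + 2%:R * ((\sum_(i < N.*2) v1 (Y N i)) * (\sum_(j < N.*2) v1 (Y N j)))
     + (\sum_(i < N.*2) v (Y N i)) * (\sum_(j < N.*2) v2 (Y N j))).
    by rewrite sv sv1; ring.
  rewrite !big_distrlr mulr_sumr -!big_split; apply: eq_bigr => i _.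
  by rewrite mulr_sumr -!big_split.
apply: (mulfI eight0); rewrite e sum_symmetric// sd so.
by ring.
Qed.

Let z2le k : `|z k ^+ 2| <= 1.
Proof. by rewrite -exprM normrX exprn_ile1// ltW. Qed.

Lemma H_bounded N i : `|H (Y N i ^+ 2)| <= 2%:R * ((1 - r) ^+ 3)^-1.
Proof.
have d0 : 0 < 1 - r by rewrite subr_gt0.
have Hz k : `|H (z k ^+ 2)| <= 2%:R * ((1 - r) ^+ 3)^-1.
  rewrite normrM normfV; apply: ler_pM; rewrite ?invr_ge0//.
    rewrite normrM -[leRHS]mul1r; apply: ler_pM => //.
    by apply: le_trans (ler_normD _ _) _; rewrite normr1 -[leRHS]/(1 + 1) lerD2l.
  have h : 1 - r <= `|1 - z k ^+ 2| by rewrite -exprM muln2; exact: norm_1BX_ge.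
  rewrite normrX lef_pV2 ?posrE ?exprn_gt0//; last exact: lt_le_trans h.
  by rewrite ler_pXn2r// nnegrE ?ltW.
have [k [->|->]] := odd_powerP N i; first exact: Hz.
by rewrite (H_inv (qn _) (oneBz2 k)) normrN.
Qed.

Let cvg_z2 : (fun k => z k ^+ 2) @ \oo --> 0.
Proof.
have -> : (fun k => z k ^+ 2) = (fun k => q ^+ 2 * (q ^+ 4) ^+ k).
  by apply/funext => k; rewrite -!exprM -exprD; congr (_ ^+ _); clear; lia.
rewrite -(mulr0 c); apply: cvgMr.
by apply: (cvgX0 Kc); exact: (normX_lt1 q1 3).
Qed.

Lemma cvg_Hz : (fun k => H (z k ^+ 2)) @ \oo --> 0.
Proof.
have h1 (e : K) : (fun k => 1 + e * z k ^+ 2) @ \oo --> 1 + e * 0.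
  by apply: cvgD; [exact: cvg_cst|apply: cvgMr].
have h2 : (fun k => (1 + -1 * z k ^+ 2)^-1) @ \oo --> ((1 + -1 * 0)^-1 : K).
  by apply: cvgV => //; rewrite mulr0 addr0 oner_eq0.
have -> : (fun k => H (z k ^+ 2)) = (fun k => z k ^+ 2 * (1 + 1 * z k ^+ 2) *
   ((1 + -1 * z k ^+ 2)^-1 * ((1 + -1 * z k ^+ 2)^-1 * (1 + -1 * z k ^+ 2)^-1))).
  apply/funext => k; rewrite !mulN1r mul1r -!exprVn.
  by rewrite -!expr2 -exprS.
have -> : (0 : K) = 0 * (1 + 1 * 0) * ((1 + -1 * 0)^-1 * ((1 + -1 * 0)^-1 * (1 + -1 * 0)^-1)).
  by rewrite !mul0r.
by apply: cvgM; apply: cvgM => //; apply: cvgM.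
Qed.

Lemma cvg_H_difference i :
  (fun N => H (Y N i ^+ 2) - H (Y N (N.*2.-1 - i) ^+ 2)) @ \oo --> (0 : K).
Proof.
pose g N := H (Y N i ^+ 2) - H (Y N (N.*2.-1 - i) ^+ 2).
rewrite -/g -(cvg_shiftn i.+1).
have -> : [sequence g (N + i.+1)%N]_N = (fun N => - H (z N ^+ 2) - H (z N ^+ 2)).
  apply/funext => N; rewrite /g; congr (_ - _).
    have := @odd_power_left (N + i.+1) N.
    have -> : (N + i.+1 - N.+1 = i)%N by clear; lia.
    by move=> ->; [exact: H_inv|clear; lia].
  have -> : ((N + i.+1).*2.-1 - i = (N + i.+1) + N)%N by clear; lia.
  by rewrite odd_power_right.
have h : (fun N => - H (z N ^+ 2) - H (z N ^+ 2)) @ \oo --> - (0 : K) - 0.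
  by apply: cvgB; [apply: cvgN|]; exact: cvg_Hz.
by move: h; rewrite oppr0 addr0.
Qed.

(** Unlike X / (1 - X), the function [H] vanishes at both ends of the lattice,
    so the off-diagonal part tends to zero and only the diagonal survives. *)
Lemma odd_square_sum_sqr (G : K) :
  (fun N => \sum_(k < N) v1 (z k)) @ \oo --> G ->
  (fun N => \sum_(k < N) T (z k ^+ 2)) @ \oo --> G ^+ 2.
Proof.
move=> hG.
have c1 : `|c| < 1 by exact: (normX_lt1 q1 1).
have [tau [E [C [tau_le tauE _ _]]]] := lambert_tails Kc (qn 2) c1.
pose f N i := tau i * (H (Y N i ^+ 2) - H (Y N (N.*2.-1 - i) ^+ 2)).
pose B := 2%:R * ((1 - r) ^+ 3)^-1.
have hf N i : `|f N i| <= C * (B + B) * `|c| ^+ i.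
  rewrite normrM [leRHS]mulrAC; apply: ler_pM; [exact: normr_ge0|exact: normr_ge0|exact: tau_le|].
  by apply: le_trans (ler_normB _ _) _; apply: lerD; exact: H_bounded.
have hfi i : f ^~ i @ \oo --> (0 : K).
  by rewrite -(mulr0 (tau i)); apply: cvgMr; exact: cvg_H_difference.
have h0 := cvg_sum0_geometric Kc (fun N => N.*2) (normr_ge0 _) c1 hf hfi.
have -> : (fun N => \sum_(k < N) T (z k ^+ 2)) = (fun N => (\sum_(k < N) v1 (z k)) * (\sum_(k < N) v1 (z k)) - \sum_(i < N.*2) f N i).
  apply/funext => N; rewrite -expr2 (sqr_odd_sum N (tau 0)).
  under [X in _ + X - _]eq_bigr do rewrite tauE.
  by rewrite addrK.
rewrite -[G ^+ 2]subr0 expr2; apply: cvgB => //; exact: cvgM.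
Qed.
End Square.

(** * The identities over a complete numeric field *)

Section Identities.
Local Open Scope classical_set_scope.
Lemma infinite_sum_eq (K : numFieldType) (F S : nat -> K) (l : K) :
    S @ \oo --> l -> (forall N, \sum_(k < N) F k.+1 = S N) ->
  \big[+%R/0]_(1 <= n <oo) F n = l.
Proof.
move=> hl FS; apply: cvg_lim; first exact: norm_hausdorff.
rewrite -(cvg_shiftS (fun N => \sum_(1 <= n < N) F n)).
suff -> : [sequence \sum_(1 <= n < N.+1) F n]_N = S by [].
by apply/funext => N; rewrite -FS /= big_add1 /= big_mkord.
Qed.

Lemma infinite_prod_eq (K : numFieldType) (F : nat -> K) (l : K) :
  (fun N => \prod_(k < N) F k) @ \oo --> l ->
  \big[*%R/1]_(0 <= n <oo) F n = l.
Proof.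
move=> hl; apply: cvg_lim; first exact: norm_hausdorff.
suff -> : (fun N => \prod_(0 <= n < N) F n) = (fun N => \prod_(k < N) F k) by [].
by apply/funext => N; rewrite big_mkord.
Qed.

(** The theorem over any numeric field in which geometrically dominated series
    converge, with psi known only through the limit of [odd_even_ratio]. *)
Lemma lambert_identities (K : numFieldType) (Kc : geometric_complete K)
    (q w p2 p3 p9 : K) (q0 : q != 0) (q1 : `|q| < 1) (w0 : 1 + w + w ^+ 2 = 0)
    (p20 : p2 != 0) (p30 : p3 != 0)
    (h2 : odd_even_ratio (q ^+ 2) @ \oo --> p2^-1)
    (h3 : odd_even_ratio (q ^+ 3) @ \oo --> p3^-1)
    (h9 : odd_even_ratio (q ^+ 9) @ \oo --> p9^-1) :
  ((p3 ^+ 3 / p9) ^+ 2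
     = (1 + 3%:R * \csum_(1 <= n <oo)
              (q ^+ (18 * n - 15) / (1 - q ^+ (18 * n - 15))
               - q ^+ (18 * n - 3) / (1 - q ^+ (18 * n - 3)))) ^+ 2
   /\
   (1 + 3%:R * \csum_(1 <= n <oo)
              (q ^+ (18 * n - 15) / (1 - q ^+ (18 * n - 15))
               - q ^+ (18 * n - 3) / (1 - q ^+ (18 * n - 3)))) ^+ 2
     = 1 + 3%:R * \csum_(1 <= n <oo)
              (q ^+ (6 * n) / (1 - q ^+ (6 * n)) ^+ 2
               + 2%:R * q ^+ (6 * n - 3) / (1 - q ^+ (6 * n - 3)) ^+ 2
               - 9%:R * q ^+ (18 * n) / (1 - q ^+ (18 * n)) ^+ 2))
  /\
  (* (b) *)
  ((q * p2 ^+ 4) ^+ 2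
     = (\csum_(1 <= n <oo)
          ((2 * n - 1)%:R * q ^+ (2 * n - 1) / (1 - q ^+ (4 * n - 2)))) ^+ 2
   /\
   (\csum_(1 <= n <oo)
          ((2 * n - 1)%:R * q ^+ (2 * n - 1) / (1 - q ^+ (4 * n - 2)))) ^+ 2
     = \csum_(1 <= n <oo)
          (6%:R * q ^+ (8 * n - 4) / (1 - q ^+ (4 * n - 2)) ^+ 4
           + q ^+ (4 * n - 2) / (1 - q ^+ (4 * n - 2)) ^+ 2)).
Proof.
have qX1 n : `|q ^+ n.+1| < 1 by rewrite normrX exprn_ilt1.
have q30 : q ^+ 3 != 0 by rewrite expf_neq0.
have p2V : p2^-1 != 0 by rewrite invr_eq0.
have p3V : p3^-1 != 0 by rewrite invr_eq0.
have h9' : odd_even_ratio (q ^+ 3 ^+ 3) @ \oo --> p9^-1 by rewrite -exprM.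
have fE : p9^-1 / p3^-1 ^+ 3 = p3 ^+ 3 / p9 by rewrite exprVn invrK mulrC.
have a1 : \csum_(1 <= n <oo)
              (q ^+ (18 * n - 15) / (1 - q ^+ (18 * n - 15))
               - q ^+ (18 * n - 3) / (1 - q ^+ (18 * n - 3))) = (p3 ^+ 3 / p9 - 1) / 3%:R.
  rewrite -fE.
  apply: (infinite_sum_eq (cubic_lambert_series Kc q30 (qX1 2) w0 p3V h3 h9')) => N; apply: eq_bigr => k _.
  rewrite -!exprM.
  have -> : (18 * k.+1 - 15 = 3 * (6 * k + 1))%N by clear; lia.
  by have -> : (18 * k.+1 - 3 = 3 * (6 * k + 5))%N by clear; lia.
have a2 : \csum_(1 <= n <oo)
              (q ^+ (6 * n) / (1 - q ^+ (6 * n)) ^+ 2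
               + 2%:R * q ^+ (6 * n - 3) / (1 - q ^+ (6 * n - 3)) ^+ 2
               - 9%:R * q ^+ (18 * n) / (1 - q ^+ (18 * n)) ^+ 2)
   = ((p3 ^+ 3 / p9) ^+ 2 - 1) / 3%:R.
  rewrite -fE.
  apply: (infinite_sum_eq (cubic_square_series Kc q30 (qX1 2) w0 p3V h3 h9')) => N; apply: eq_bigr => k _.
  rewrite -!exprM.
  have -> : (6 * k.+1 = 3 * k.+1.*2)%N by clear; lia.
  have -> : (3 * k.+1.*2 - 3 = 3 * k.*2.+1)%N by clear; lia.
  by have -> : (18 * k.+1 = 3 * k.+1.*2 * 3)%N by clear; lia.
have S := cvg_odd_square_sum Kc q0 q1 p2V h2.
have b1 : \csum_(1 <= n <oo)
          ((2 * n - 1)%:R * q ^+ (2 * n - 1) / (1 - q ^+ (4 * n - 2))) = q / p2^-1 ^+ 4.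
  apply: (infinite_sum_eq (odd_lambert_series Kc q1 S)) => N; apply: eq_bigr => k _.
  rewrite -!exprM.
  have -> : (2 * k.+1 - 1 = k.*2.+1)%N by clear; lia.
  by have -> : (4 * k.+1 - 2 = k.*2.+1 * 2)%N by clear; lia.
have b2 : \csum_(1 <= n <oo)
          (6%:R * q ^+ (8 * n - 4) / (1 - q ^+ (4 * n - 2)) ^+ 4
           + q ^+ (4 * n - 2) / (1 - q ^+ (4 * n - 2)) ^+ 2) = (q / p2^-1 ^+ 4) ^+ 2.
  apply: (infinite_sum_eq (odd_square_sum_sqr Kc q0 q1 S)) => N; apply: eq_bigr => k _.
  have -> : (8 * k.+1 - 4 = k.*2.+1 * 2 * 2)%N by clear; lia.
  have -> : (4 * k.+1 - 2 = k.*2.+1 * 2)%N by clear; lia.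
  have := @expn_neq1 _ q q1 k.*2.*2.+1.
  have -> : (k.*2.*2.+2 = k.*2.+1 * 2)%N by clear; lia.
  rewrite !exprM eq_sym -subr_eq0; move: (q ^+ k.*2.+1 ^+ 2) => y y1.
  by field.
have affine (y : K) : 1 + 3%:R * ((y - 1) / 3%:R) = y by field.
by rewrite a1 a2 b1 b2 !affine exprVn invrK.
Qed.

End Identities.

(** * The complex numbers *)

Local Open Scope complex_scope.

Section Complex.
Local Open Scope classical_set_scope.
Variable R : realType.

Lemma normc_ge_Im (x : R[i]) : `|complex.Im x|%:C <= `|x|.
Proof.
by rewrite -normrN -ReiNIm; apply: le_trans (normc_ge_Re _) _;
   rewrite normrM [`|'i%C|]normc_def /= expr0n add0r expr1n sqrtr1 mulr1.
Qed.

Lemma normc_le_ReIm (x : R[i]) :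
  `|x| <= (`|complex.Re x| + `|complex.Im x|)%:C.
Proof.
rewrite {1}(complexE x); apply: le_trans (ler_normD _ _) _.
rewrite normrM rmorphD /= [`|'i%C|]normc_def /= expr0n add0r expr1n sqrtr1 mul1r.
by rewrite !normc_def /= !expr0n !addr0 !sqrtr_sqr lexx.
Qed.

Lemma real_geometric_complete : geometric_complete R.
Proof.
move=> v C r r0 r1 hv.
have C0 : 0 <= C by have := hv 0; rewrite expr0 mulr1; apply: le_trans.
have : cvgn (series v).
  apply: normed_cvg; apply: (@series_le_cvg _ _ (geometric C r)) => //.
  - by move=> n; rewrite normr_ge0.
  - by move=> n; rewrite /geometric /= mulr_ge0 ?exprn_ge0.
  - by apply: is_cvg_geometric_series; rewrite ger0_norm.
move=> /cvg_ex[l hl]; exists l.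
suff -> : (fun N => \sum_(n < N) v n) = series v by [].
by apply/funext => N; rewrite /series /= big_mkord.
Qed.

(** Convergence of the real and imaginary parts. *)
Lemma complex_geometric_complete : geometric_complete R[i].
Proof.
move=> u C r r0 r1 hu.
have rE : r = (complex.Re r)%:C by rewrite RRe_real// ger0_real.
have C0 : 0 <= C by have := hu 0; rewrite expr0 mulr1; apply: le_trans.
have CE : C = (complex.Re C)%:C by rewrite RRe_real// ger0_real.
move: r0 r1 hu; rewrite rE CE -{1}(rmorph0 (real_complex R)) -(rmorph1 (real_complex R)).
rewrite lecR ltcR => r0 r1 hu.
have hb n : (complex.Re C)%:C * (complex.Re r)%:C ^+ n = (complex.Re C * complex.Re r ^+ n)%:C.
  by rewrite rmorphM rmorphXn.
have [n|a ha] := @real_geometric_complete (fun n => complex.Re (u n)) (complex.Re C) _ r0 r1.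
  by rewrite -lecR; apply: le_trans (normc_ge_Re _) _; rewrite -hb.
have [n|b hb'] := @real_geometric_complete (fun n => complex.Im (u n)) (complex.Re C) _ r0 r1.
  by rewrite -lecR; apply: le_trans (normc_ge_Im _) _; rewrite -hb.
exists (a +i* b).
have sumRe N : complex.Re (\sum_(n < N) u n) = \sum_(n < N) complex.Re (u n).
  by rewrite raddf_sum.
have sumIm N : complex.Im (\sum_(n < N) u n) = \sum_(n < N) complex.Im (u n).
  by rewrite raddf_sum.
apply: (cvgrPdist_le _ _).2 => e e0.
have eE : e = (complex.Re e)%:C by rewrite RRe_real// ger0_real// ltW.
move: e0; rewrite eE -{1}(rmorph0 (real_complex R)) ltcR => e0.
have e20 : 0 < complex.Re e / 2%:R by rewrite divr_gt0.
near=> N.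
apply: le_trans (normc_le_ReIm _) _.
rewrite lecR (splitr (complex.Re e)) !raddfB /= sumRe sumIm.
apply: lerD; near: N.
  by move/cvgrPdist_le: ha; apply.
by move/cvgrPdist_le: hb'; apply.
Unshelve. all: by end_near.
Qed.
End Complex.

Section ComplexField.
Local Open Scope classical_set_scope.
Variable R : realType.
Let Kc := @complex_geometric_complete R.

Lemma odd_even_ratio_psi (c : R[i]) : `|c| < 1 ->
  psi c != 0 /\
  (odd_even_ratio c : nat -> (R[i] : numFieldType)) @ \oo --> ((psi c)^-1 : (R[i] : numFieldType)).
Proof.
move=> c1; have [L1 [L2 [B [L10 L20 h1 h2 [hu _]]]]] := cvg_odd_even_ratio Kc c1.
have e1 : qpoch c (c ^+ 2) = L1.
  exact (@infinite_prod_eq R[i] (fun i => 1 - c * (c ^+ 2) ^+ i) L1 h1).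
have e2 : qpoch (c ^+ 2) (c ^+ 2) = L2.
  exact (@infinite_prod_eq R[i] (fun i => 1 - c ^+ 2 * (c ^+ 2) ^+ i) L2 h2).
have -> : psi c = L2 / L1 by rewrite /psi e1 e2.
by split; [rewrite mulf_neq0// invr_neq0|rewrite invf_div; exact hu].
Qed.

Lemma norm_cexp (z : R[i]) : `|cexp z| = (expR (complex.Re z))%:C.
Proof.
rewrite /cexp normrM !normc_def /= cos2Dsin2 sqrtr1 mulr1 expr0n addr0 sqrtr_sqr.
by rewrite ger0_norm// expR_ge0.
Qed.

Lemma exists_cube_root : exists w : R[i], 1 + w + w ^+ 2 = 0.
Proof.
exists ((-1 + sqrtc (- 3%:R)) / 2%:R).
have two0 : (2%:R : R[i]) != 0 by rewrite pnatr_eq0.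
have := sqr_sqrtc (- 3%:R : R[i]); move: (sqrtc _) => s hs.
transitivity ((3%:R + s ^+ 2) / 4%:R).
  by field.
by rewrite hs addrC addNr mul0r.
Qed.

End ComplexField.

Theorem theorem4 (R : realType) (tau q : R[i])
    (htau : 0 < complex.Im tau) (hq : q = cexp ((pi : R)%:C * 'i%C * tau)) :
  (* (a) *)
  ((psi (q ^+ 3) ^+ 3 / psi (q ^+ 9)) ^+ 2
     = (1 + 3%:R * \csum_(1 <= n <oo)
              (q ^+ (18 * n - 15) / (1 - q ^+ (18 * n - 15))
               - q ^+ (18 * n - 3) / (1 - q ^+ (18 * n - 3)))) ^+ 2
   /\
   (1 + 3%:R * \csum_(1 <= n <oo)
              (q ^+ (18 * n - 15) / (1 - q ^+ (18 * n - 15))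
               - q ^+ (18 * n - 3) / (1 - q ^+ (18 * n - 3)))) ^+ 2
     = 1 + 3%:R * \csum_(1 <= n <oo)
              (q ^+ (6 * n) / (1 - q ^+ (6 * n)) ^+ 2
               + 2%:R * q ^+ (6 * n - 3) / (1 - q ^+ (6 * n - 3)) ^+ 2
               - 9%:R * q ^+ (18 * n) / (1 - q ^+ (18 * n)) ^+ 2))
  /\
  (* (b) *)
  ((q * psi (q ^+ 2) ^+ 4) ^+ 2
     = (\csum_(1 <= n <oo)
          ((2 * n - 1)%:R * q ^+ (2 * n - 1) / (1 - q ^+ (4 * n - 2)))) ^+ 2
   /\
   (\csum_(1 <= n <oo)
          ((2 * n - 1)%:R * q ^+ (2 * n - 1) / (1 - q ^+ (4 * n - 2)))) ^+ 2
     = \csum_(1 <= n <oo)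
          (6%:R * q ^+ (8 * n - 4) / (1 - q ^+ (4 * n - 2)) ^+ 4
           + q ^+ (4 * n - 2) / (1 - q ^+ (4 * n - 2)) ^+ 2)).
Proof.
have q1 : `|q| < 1.
  rewrite hq norm_cexp -(rmorph1 (real_complex R)) ltcR expR_lt1.
  rewrite mulrAC ReiNIm oppr_lt0 (_ : complex.Im _ = pi * complex.Im tau).
    by rewrite mulr_gt0// pi_gt0.
  by case: tau {htau hq} => a b /=; rewrite mul0r addr0.
have q0 : q != 0.
  by rewrite -normr_gt0 hq norm_cexp -(rmorph0 (real_complex R)) ltcR expR_gt0.
have qX1 n : `|q ^+ n.+1| < 1 by rewrite normrX exprn_ilt1.
have [p20 h2] := odd_even_ratio_psi (qX1 1).
have [p30 h3] := odd_even_ratio_psi (qX1 2).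
have [_ h9] := odd_even_ratio_psi (qX1 8).
have [w w0] := exists_cube_root R.
exact (lambert_identities (@complex_geometric_complete R) q0 q1 w0 p20 p30 h2 h3 h9).
Qed.
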